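(* Let $G=(V,E)$ be a graph with $n=|V|$ and integer edge weights $u:E\to\mathbb{Z}_{+}$, viewed as a multigraph with $u_e$ parallel copies of each edge $e$. Let $\epsilon\ge 1/n$ and $\rho := d\log^2 n$ with $d=C/\epsilon^2$ for a suitable absolute constant $C$. Consider the procedure: compute the effective conductance $c_e$ of every edge; start with $E'=\emptyset$, $w\equiv 0$; for each of $\rho$ rounds, independently pick a uniformly random spanning tree $T$ of the multigraph, and for each (copy of an) edge $e$ in $T$, add $e$ to $E'$ (if not already present) and increase $w_e$ by $c_e/\rho$. Then with high probability the output $G'=(V,E')$ with weights $w$ satisfies $|u(\delta(S))-w(\delta(S))|\le\epsilon\,u(\delta(S))$ for all $S\subseteq V$. (Moreover $|E'|\le\rho(n-1)=O(n\log^2 n/\epsilon^2)$.)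
   Context: $\delta(S)$ is the set of edges with exactly one endpoint in $S$; $x(F)=\sum_{e\in F}x_e$. For an edge $e=st$, the effective conductance $c_e$ is the current that flows from $s$ to $t$ when each edge $f$ is a resistor of conductance $u_f$ and a unit voltage difference is imposed between $s$ and $t$. ''With high probability'' means with probability at least $1-n^{-c}$ for some constant $c>0$. *)

(* Defs.v *)
From Stdlib Require Import ClassicalEpsilon.
From HB Require Import structures.
From mathcomp Require Import all_boot all_order all_algebra.
From mathcomp Require Import all_classical all_reals all_analysis.
From mathcomp Require Import Rstruct.
Set Implicit Arguments. Unset Strict Implicit. Unset Printing Implicit Defensive.
Import Order.TTheory GRing.Theory Num.Theory.
Local Open Scope ring_scope.

Notation RR := Rdefinitions.R.

Section Graph.
Variables (V E : finType) (s t : E -> V).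

Definition simple_graph : Prop :=
  (forall e, s e != t e) /\
  (forall e f, [set s e; t e] = [set s f; t f] -> e = f).

Definition gadj : rel V := fun x y =>
  [exists e, ((s e == x) && (t e == y)) || ((s e == y) && (t e == x))].

Definition graph_connected : Prop := forall x y, connect gadj x y.

Definition in_cut (S : {set V}) (e : E) : bool := (s e \in S) != (t e \in S).

Variable (u : E -> nat).

Definition current_out (phi : V -> RR) (v : V) : RR :=
  \sum_(f : E) (if s f == v then (u f)%:R * (phi v - phi (t f))
                else if t f == v then (u f)%:R * (phi v - phi (s f))
                else 0).

(* c is the current flowing from s e to t e when a unit voltage is imposed
   between s e and t e (Kirchhoff's current law at every other vertex). *)
Definition is_eff_cond (e : E) (c : RR) : Prop :=
  exists phi : V -> RR,
    phi (s e) = 1 /\ phi (t e) = 0 /\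
    (forall v, v != s e -> v != t e -> current_out phi v = 0) /\
    c = current_out phi (s e).

Definition eff_cond (e : E) : RR := epsilon (inhabits 0) (is_eff_cond e).

Definition Copy := {e : E & 'I_(u e)}.

Definition madj (F : {set Copy}) : rel V := fun x y =>
  [exists c in F, ((s (tag c) == x) && (t (tag c) == y))
               || ((s (tag c) == y) && (t (tag c) == x))].

(* F is a spanning tree of the multigraph: (V,F) is connected and acyclic
   (no copy of F lies on a cycle of F, i.e. its endpoints are not connected
   in F minus that copy). *)
Definition spanning_tree (F : {set Copy}) : bool :=
  [forall x, [forall y, connect (madj F) x y]] &&
  [forall c in F, ~~ connect (madj (F :\ c)) (s (tag c)) (t (tag c))].

Variable rho : nat.

Definition outcome := {ffun 'I_rho -> {set Copy}}.

Definition valid (f : outcome) : bool := [forall k, spanning_tree (f k)].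

Definition out_weight (f : outcome) (e : E) : RR :=
  \sum_(k < rho) (#|[set c in f k | tag c == e]|)%:R * (eff_cond e / rho%:R).

Definition out_edges (f : outcome) : {set E} :=
  [set e | [exists k, [exists c in f k, tag c == e]]].

Definition cut_approx (eps : RR) (f : outcome) : bool :=
  [forall S : {set V},
     `| \sum_(e | in_cut S e) (u e)%:R - \sum_(e | in_cut S e) out_weight f e |
       <= eps * \sum_(e | in_cut S e) (u e)%:R ].

(* The rho rounds pick independent uniformly random spanning trees, i.e. the
   outcome is uniform on the set of valid outcomes. *)
Definition prob_cut_approx (eps : RR) : RR :=
  #|[set f : outcome | valid f && cut_approx eps f]|%:R /
  #|[set f : outcome | valid f]|%:R.

End Graph.

Definition rounds (C eps : RR) (n : nat) : nat :=
  `| Num.ceil (C / eps ^+ 2 * (ln (n%:R : RR)) ^+ 2) |%N.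

(* Main.v *)
Require Import Defs.
From Stdlib Require Import ClassicalEpsilon.
From HB Require Import structures.
From mathcomp Require Import all_boot all_order all_algebra.
From mathcomp Require Import ring lra.
Set Implicit Arguments. Unset Strict Implicit. Unset Printing Implicit Defensive.
Import Order.TTheory GRing.Theory Num.Theory.
Local Open Scope ring_scope.

(** The weighted cut of a tree or of the graph is a Laplacian quadratic form
    evaluated at the indicator of [S], so it suffices to bound
    [sum_k (M_(T_k) - L)] spectrally, where [M_T = sum_(c in T) c_e L_c] and [L]
    is the Laplacian.  This is the matrix martingale argument of Kyng and Song,
    which covers all [eps > 0].

    Counting trees gives the electrical facts.  For a set [A] of edges let [N A]
    be the number of spanning trees containing [A], and for [e] outside [A] let
    [Phi v] be the number of trees [T] through [A] and [e] in which [v] and one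
    chosen end of [e] remain connected in [T - e].  Exchanging edges shows that
    [Phi] is a potential: its Dirichlet form against any [psi] constant along [A]
    is [N A] times the drop of [psi] across [e].  Hence [c_e = N 0 / N {e}], and
    Cauchy-Schwarz gives both [c_e L_e <= L] and the negative correlation
    [N A * N (A+e+g) <= N (A+e) * N (A+g)].

    Expose the [k = n - 1] edges of [T] in a uniformly random order, and let [Z A]
    be the conditional mean of [M_T] given [A].  An increment [Z (A+e) - Z A] is a
    gain [c_e L_e] minus a loss; negative correlation makes both lie between [0]
    and [L], and both have conditional mean at most [L / (k - |A|)].  So the
    increments are bounded and the conditional variances sum to [O(log n)] per
    tree.  The usual trace-exponential bound then applies.  The exponential is
    replaced by [(1 + x / M) ^ M] with [M] a large power of two, for which the
    Lieb-Thirring inequality (in place of Golden-Thompson) follows from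
    Cauchy-Schwarz alone. *)

(** * Spanning trees and potentials *)

Section Multigraph.
Variables (V X : finType) (s t : X -> V).
Implicit Types (A F T : {set X}) (c e f g : X) (x y v : V).

Definition adj F : rel V := fun x y =>
  [exists c in F, ((s c == x) && (t c == y)) || ((s c == y) && (t c == x))].

Definition is_tree F : bool :=
  [forall x, [forall y, connect (adj F) x y]] &&
  [forall c in F, ~~ connect (adj (F :\ c)) (s c) (t c)].

Lemma adj_sym F : symmetric (adj F).
Proof. by move=> x y; apply: eq_existsb => c; rewrite orbC. Qed.

Lemma conn_sym F x y : connect (adj F) x y = connect (adj F) y x.
Proof. by exact: (sym_connect_sym (adj_sym F)). Qed.

Lemma adj_edge F c : c \in F -> adj F (s c) (t c).
Proof. by move=> cF; apply/existsP; exists c; rewrite cF !eqxx. Qed.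

Lemma conn_edge F c : c \in F -> connect (adj F) (s c) (t c).
Proof. by move=> cF; apply: connect1; apply: adj_edge. Qed.

Lemma adjP F x y : reflect (exists2 c, c \in F &
    (s c = x /\ t c = y) \/ (s c = y /\ t c = x)) (adj F x y).
Proof.
apply: (iffP existsP) => [[c /andP[cF]]|[c cF H]].
  by case/orP => /andP[/eqP <- /eqP <-]; exists c => //; [left|right].
by exists c; rewrite cF /=; case: H => -[-> ->]; rewrite !eqxx ?orbT.
Qed.

Lemma conn_sub F F' x y : F \subset F' ->
  connect (adj F) x y -> connect (adj F') x y.
Proof.
move=> /subsetP sF; apply: connect_sub => a b /adjP[c cF H].
by apply: connect1; apply/adjP; exists c => //; apply: sF.
Qed.

Lemma conn_eq F x y z : connect (adj F) x y ->
  connect (adj F) x z = connect (adj F) y z.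
Proof.
move=> xy; apply/idP/idP; apply: connect_trans => //.
by rewrite conn_sym.
Qed.

Lemma conn_edge_eq F c x : c \in F ->
  connect (adj F) (s c) x = connect (adj F) (t c) x.
Proof. by move=> cF; apply: conn_eq; apply: conn_edge. Qed.

(** A walk that uses [f] several times can be shortened to use it at most once, in one of its two
    directions. *)
Lemma conn_add F f x y : connect (adj (f |: F)) x y ->
  [|| connect (adj F) x y,
      connect (adj F) x (s f) && connect (adj F) (t f) y |
      connect (adj F) x (t f) && connect (adj F) (s f) y].
Proof.
case/connectP => p; elim: p x => [|z p IH] x /=.
  by move=> _ ->; rewrite connect0.
case/andP => /adjP[c]; rewrite in_setU1 => /orP[/eqP ->|cF] H /IH{}IH /IH.
  case: H => -[<- <-]; case/or3P=> [|/andP[_]|/andP[_]] => ->;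
   by rewrite ?connect0 ?orbT.
have xz : connect (adj F) x z by apply: connect1; apply/adjP; exists c.
case/or3P=> [h|/andP[h ->]|/andP[h ->]];
  by rewrite (connect_trans xz h) ?orbT.
Qed.

Lemma conn_rem F c x y : connect (adj (F :\ c)) (s c) (t c) ->
  connect (adj F) x y -> connect (adj (F :\ c)) x y.
Proof.
move=> H; apply: connect_sub => a b /adjP[d dF ab].
have [dc|dc] := eqVneq d c.
  by rewrite dc in ab; case: ab => -[<- <-] //; rewrite conn_sym.
by apply: connect1; apply/adjP; exists d; rewrite // !inE dc.
Qed.

Lemma tree_conn T x y : is_tree T -> connect (adj T) x y.
Proof. by case/andP => /forallP/(_ x)/forallP/(_ y). Qed.

Lemma tree_bridge T c : is_tree T -> c \in T ->
  connect (adj (T :\ c)) (s c) (t c) = false.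
Proof. by case/andP => _ /forall_inP H cT; apply/negbTE/H. Qed.

(** Putting [c] back reconnects everything, so removing it leaves exactly two components. *)
Lemma tree_side T c x : is_tree T -> c \in T ->
  connect (adj (T :\ c)) (t c) x = ~~ connect (adj (T :\ c)) (s c) x.
Proof.
move=> tT cT; have Nst := tree_bridge tT cT.
have := tree_conn (s c) x tT; rewrite -{1}(setD1K cT) => /conn_add.
rewrite connect0 Nst /= orbC.
case tx: connect; case sx: connect => //= _.
by rewrite -Nst (connect_trans sx) // conn_sym.
Qed.

(** A minimal connecting edge set is a tree: by [conn_rem] an edge on a cycle could be dropped. *)
Lemma exists_tree : (forall x y, connect (adj setT) x y) ->
  exists T, is_tree T.
Proof.
move=> cT; pose P F := [forall x, [forall y, connect (adj F) x y]].
have PT : P setT by apply/forallP => x; apply/forallP => y.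
have [T /minsetP[PTT minT] _] := @minset_exists _ P _ PT.
exists T; rewrite /is_tree -/(P T) PTT /=; apply/forall_inP => c cTT; apply/negP => H.
have : P (T :\ c).
  apply/forallP => x; apply/forallP => y; apply: conn_rem H _.
  by move/forallP: PTT => /(_ x)/forallP.
move=> /minT/(_ (subD1set _ _)) E; by move: cTT; rewrite -E !inE eqxx.
Qed.

(** [T - e] has two components and [f] joins them, so the new set connects. A cycle in it would have
    to use [f], which would connect the ends of [f] inside [T - e]. *)
Lemma exchange T e f : is_tree T -> e \in T ->
  ~~ connect (adj (T :\ e)) (s f) (t f) ->
  [/\ is_tree (f |: (T :\ e)), f \notin T :\ e &
      (f |: (T :\ e)) :\ f = T :\ e].
Proof.
move=> tT eT; set F := T :\ e => Nst.
have fF : f \notin F by apply: contraNN Nst; apply: conn_edge.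
have ef : (f |: F) :\ f = F.
  apply/setP=> g; rewrite in_setD1 in_setU1.
  by have [->|//] := eqVneq g f; rewrite (negbTE fF).
split => //; apply/andP; split.
  suff H x : connect (adj (f |: F)) x (s e).
    apply/forallP=> x; apply/forallP=> y; apply: (connect_trans (H x)).
    by rewrite conn_sym.
  have FfF : F \subset f |: F by apply: subsetUr.
  have sides z : connect (adj F) z (t e) = ~~ connect (adj F) z (s e).
    by rewrite conn_sym (tree_side z tT eT) conn_sym.
  have ts : connect (adj (f |: F)) (t e) (s e).
    have := sides (s f); have := sides (t f).
    case sf: (connect _ (s f) (s e)); case tf: (connect _ (t f) (s e)) => /=.
    - by move/negP: Nst; case; rewrite (connect_trans sf) // conn_sym.
    - rewrite conn_sym => H _; apply: connect_trans (conn_sub FfF H) _.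
      by rewrite -(conn_edge_eq (s e) (setU11 f F)) (conn_sub FfF).
    - rewrite [in X in _ -> X -> _]conn_sym => _ H.
      apply: connect_trans (conn_sub FfF H) _.
      by rewrite (conn_edge_eq (s e) (setU11 f F)) (conn_sub FfF).
    - move=> h1 h2; move/negP: Nst; case; apply: connect_trans h2 _.
      by rewrite conn_sym.
  case sx: (connect (adj F) x (s e)); first exact: conn_sub FfF _.
  by move: (sides x); rewrite sx => /(conn_sub FfF) H; apply: connect_trans H _.
apply/forall_inP => g; rewrite in_setU1 => /orP[/eqP->|gF].
  by rewrite ef Nst.
have gf : g != f by apply: contraNneq fF => <-.
have -> : (f |: F) :\ g = f |: (F :\ g).
  apply/setP=> z; rewrite in_setD1 !in_setU1 in_setD1.
  by have [->|//] := eqVneq z g; rewrite (negbTE gf).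
have gFs : F :\ g \subset F by apply: subD1set.
have gT : g \in T by move: gF; rewrite !inE => /andP[].
have Ng : connect (adj (F :\ g)) (s g) (t g) = false.
  apply/negP => H; suff: connect (adj (T :\ g)) (s g) (t g).
    by rewrite (tree_bridge tT gT).
  by apply: conn_sub H; rewrite setSD // subD1set.
have sgtg := conn_edge gF.
apply/negP=> /conn_add; rewrite Ng /=.
case/orP=> /andP[/(conn_sub gFs) h1 /(conn_sub gFs) h2]; move/negP: Nst; apply.
  rewrite conn_sym in h1; apply: connect_trans h1 _.
  by apply: connect_trans sgtg _; rewrite conn_sym.
apply: connect_trans h2 _; apply: connect_trans _ h1.
by rewrite conn_sym.
Qed.

Variable R : realFieldType.
Implicit Types (phi psi : V -> R).

Definition grad psi f : R := psi (s f) - psi (t f).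

(* The difference of indicators is the signed indicator of the tree path from
   [x] to [y]. *)
Lemma tree_path_drop T psi x y : is_tree T ->
  \sum_(f in T) ((connect (adj (T :\ f)) (s f) x)%:R
                 - (connect (adj (T :\ f)) (s f) y)%:R) * grad psi f
  = psi x - psi y.
Proof.
move=> tT.
pose h z := \sum_(f in T) (connect (adj (T :\ f)) (s f) z)%:R * grad psi f - psi z.
suff H : h x = h y.
  under eq_bigr do rewrite mulrBl.
  by rewrite sumrB; move: H; rewrite /h => H; lra.
(* Crossing a tree edge [c] changes only its own term of the sum, by exactly the drop of [psi], so
   [h] is constant along the tree. *)
have edge c : c \in T -> h (s c) = h (t c).
  move=> cT; rewrite /h !(bigD1 c cT) /= connect0 (tree_bridge tT cT).
  rewrite mul0r mul1r /grad.
  rewrite [X in _ + X - _](_ : _ = \sum_(i in T | i != c)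
     (connect (adj (T :\ i)) (s i) (t c))%:R * (psi (s i) - psi (t i))).
    by ring.
  apply: eq_bigr => f /andP[fT fc].
  by rewrite conn_sym (@conn_edge_eq _ c) 1?conn_sym // !inE eq_sym fc.
case/connectP: (tree_conn x y tT) => p; elim: p x => [|z p IH] x /=.
  by move=> _ ->.
case/andP => /adjP[c cT H] /IH{}IH /IH <-.
by case: H => -[<- <-]; rewrite (edge c cT).
Qed.

(** Take for [psi] the indicator of [v] in [tree_path_drop], from [v] to [r], and sum over [v]: each
    tree edge contributes 1, and the drops add up to [#|V| - 1]. *)
Lemma card_tree T (r : V) : is_tree T -> (#|T| = #|V| - 1)%N.
Proof.
move=> tT; apply/eqP; rewrite -(eqr_nat R) natrB; last by apply/card_gt0P; exists r.
apply/eqP.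
have H v := tree_path_drop (fun z => (z == v)%:R) v r tT.
have : \sum_v ((v == v)%:R - (r == v)%:R) = \sum_(f in T) (1 : R).
  under eq_bigr do rewrite -H.
  rewrite exchange_big /=; apply: eq_bigr => f fT.
  rewrite /grad; under eq_bigr do rewrite mulrBr.
  rewrite sumrB.
  have D (a : V) (G : V -> R) : \sum_v G v * (a == v)%:R = G a.
    rewrite (bigD1 a) //= eqxx mulr1 big1 ?addr0 // => i.
    by rewrite eq_sym => /negbTE->; rewrite mulr0.
  by rewrite !D connect0 (tree_bridge tT fT) /=; lra.
rewrite sumr_const => <-; rewrite sumrB; congr (_ - _).
  by under eq_bigr do rewrite eqxx; rewrite sumr_const.
by rewrite (bigD1 r) //= eqxx big1 ?addr0 // => i; rewrite eq_sym => /negbTE->.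
Qed.

Definition ntree A : R := #|[set T | is_tree T & A \subset T]|%:R.

Definition ener phi psi : R := \sum_f grad phi f * grad psi f.

(** Divided by [ntree A], when this is nonzero and [e] is outside [A], this is the voltage of a unit
    current from [s e] to [t e] in the graph with [A] contracted. *)
Definition tree_pot A e v : R :=
  \sum_(T | is_tree T && ((e |: A) \subset T))
     (connect (adj (T :\ e)) v (s e))%:R.

Lemma ntreeE A : ntree A = \sum_(T | is_tree T && (A \subset T)) 1.
Proof. by rewrite /ntree sumr_const cardsE. Qed.

Lemma tree_pot_flat A e f : e \notin A -> f \in A -> grad (tree_pot A e) f = 0.
Proof.
move=> eA fA; rewrite /grad -sumrB big1 // => T /andP[_ /subsetP sT].
rewrite (@conn_edge_eq _ f) ?subrr // !inE sT ?in_setU1 ?fA ?orbT // andbT.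
by apply: contraNneq eA => <-.
Qed.

Lemma grad_tree_pot A e : grad (tree_pot A e) e = ntree (e |: A).
Proof.
rewrite /grad -sumrB ntreeE; apply: eq_bigr => T /andP[tT /subsetP sT].
by rewrite connect0 conn_sym (tree_bridge tT) ?subr0 // sT // setU11.
Qed.

(* Kirchhoff: swapping [e] for [f] turns the trees through [e] into the trees
   through [f] whose path between the ends of [e] uses [f]. *)
Lemma ener_tree_pot A e psi : e \notin A -> {in A, forall f, grad psi f = 0} ->
  ener (tree_pot A e) psi = ntree A * grad psi e.
Proof.
move=> eA flat.
pose cr F f : R := (connect (adj F) (s f) (s e))%:R - (connect (adj F) (t f) (s e))%:R.
have cr0 F f : cr F f != 0 ->
    connect (adj F) (s f) (s e) != connect (adj F) (t f) (s e).
  by apply: contraNneq; rewrite /cr => ->; rewrite subrr.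
transitivity (\sum_(f | f \notin A)
   \sum_(T | is_tree T && ((e |: A) \subset T)) cr (T :\ e) f * grad psi f).
  rewrite /ener [RHS]big_mkcond; apply: eq_bigr => f _.
  case: ifPn => [_|/negPn fA]; last by rewrite flat ?mulr0.
  by rewrite /grad -sumrB mulr_suml.
transitivity (\sum_(f | f \notin A)
   \sum_(T | is_tree T && ((f |: A) \subset T))
     ((connect (adj (T :\ f)) (s f) (s e))%:R
       - (connect (adj (T :\ f)) (s f) (t e))%:R) * grad psi f).
  apply: eq_bigr => f fA; rewrite -!mulr_suml; congr (_ * _).
  rewrite (bigID (fun T => connect (adj (T :\ e)) (s f) (t f))) /=.
  rewrite big1 ?add0r; last first.
    by move=> T /andP[_ c]; rewrite /cr (conn_eq _ c) subrr.
  rewrite [RHS](bigID (fun T => connect (adj (T :\ f)) (s e) (t e))) /=.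
  rewrite [X in _ = X + _]big1 ?add0r; last first.
    move=> T /andP[_ c].
    by rewrite ![connect _ (s f) _]conn_sym (conn_eq _ c) subrr.
  (* Trading [e] for [f] and trading back are inverse maps between the trees through [e] where [f]
     crosses [T - e] and the trees through [f] where [e] crosses [T - f]. *)
  pose h f e T := e |: (T :\ f).
  have key e' f' T : e' \notin A -> f' \notin A ->
      is_tree T && (e' |: A \subset T) && ~~ connect (adj (T :\ e')) (s f') (t f') ->
      [/\ h f' e' (h e' f' T) = T, is_tree (h e' f' T) &&
          (f' |: A \subset h e' f' T) & (h e' f' T) :\ f' = T :\ e'].
    move=> e'A f'A /andP[/andP[tT]]; rewrite subUset sub1set => /andP[eT AT] cr'.
    have [tT' fT' E] := exchange tT eT cr'.
    rewrite /h tT' E setD1K //; split => //.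
    by rewrite subUset sub1set setU11 /= subsetU // subsetD1 AT e'A orbT.
  have keyb e' f' T : e' \notin A -> f' \notin A ->
      is_tree T && (e' |: A \subset T) && ~~ connect (adj (T :\ e')) (s f') (t f') ->
      is_tree (h e' f' T) && (f' |: A \subset h e' f' T) &&
        ~~ connect (adj ((h e' f' T) :\ f')) (s e') (t e').
    move=> e'A f'A H; have [_ -> ->] := key e' f' T e'A f'A H.
    move: H => /andP[/andP[tT]]; rewrite subUset sub1set => /andP[eT AT] _.
    by rewrite tree_bridge.
  rewrite (reindex_onto (h f e) (h e f)) /=; last first.
    by move=> T H; have [] := key e f T eA fA H.
  apply: eq_big => [T|T /andP[H /eqP hT]].
    apply/idP/idP => [/andP[H /eqP hT]|H].
      by rewrite -hT; apply: keyb.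
    have [-> _ _] := key f e T fA eA H; rewrite eqxx andbT; exact: keyb.
  have [_ _ E] := key e f _ eA fA H; rewrite hT in E; rewrite -E /cr.
  have tT : is_tree T by have [_ /andP[+ _] _] := key e f _ eA fA H; rewrite hT.
  have fT : f \in T.
    have [_ /andP[_ +] _] := key e f _ eA fA H; rewrite hT => /subsetP; apply.
    exact: setU11.
  have eT : is_tree (h f e T) /\ e \in h f e T.
    by move: H => /andP[/andP[-> /subsetP sT] _]; rewrite sT ?setU11.
  have s1 := tree_side (s e) tT fT; rewrite s1.
  have := tree_side (s f) eT.1 eT.2; rewrite -E => s2.
  by rewrite [connect _ (s f) (t e)]conn_sym s2 [connect _ (s e) (s f)]conn_sym.
(* For a fixed tree the remaining sum over its edges is the path sum of [tree_path_drop]; the edges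
   of [A] add nothing since [psi] is flat there. *)
rewrite (exchange_big_dep (fun T => is_tree T && (A \subset T))) /=; last first.
  by move=> f T _; rewrite subUset => /and3P[-> _ ->].
rewrite ntreeE mulr_suml; apply: eq_bigr => T /andP[tT AT].
rewrite mul1r -[grad psi e](tree_path_drop psi (s e) (t e) tT) [RHS](bigID (mem A)) /=.
rewrite [X in _ = X + _]big1 ?add0r; last first.
  by move=> f /andP[_ fA]; rewrite flat ?mulr0.
apply: eq_bigl => f; rewrite tT subUset sub1set AT /= andbT andbC.
by [].
Qed.

Lemma ener_ge0 phi : 0 <= ener phi phi.
Proof. by apply: sumr_ge0 => f _; rewrite -expr2 sqr_ge0. Qed.

Lemma enerC phi psi : ener phi psi = ener psi phi.
Proof. by apply: eq_bigr => f _; rewrite mulrC. Qed.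

Lemma ener_CS phi psi : ener phi psi ^+ 2 <= ener phi phi * ener psi psi.
Proof.
have [z|nz] := eqVneq (ener phi phi) 0.
  suff -> : ener phi psi = 0 by rewrite expr0n /= mulr_ge0 ?ener_ge0.
  apply: big1 => f _; move/eqP: z; rewrite psumr_eq0; last first.
    by move=> g _; rewrite -expr2 sqr_ge0.
  by move=> /allP/(_ f); rewrite mem_index_enum mulf_eq0 orbb => /(_ isT)/eqP->;
    rewrite mul0r.
have pos : 0 < ener phi phi by rewrite lt_def nz ener_ge0.
have sq (x y : R) : \sum_f (x * grad phi f - y * grad psi f) ^+ 2 =
    x ^+ 2 * ener phi phi + (y ^+ 2 * ener psi psi - 2%:R * x * y * ener phi psi).
  rewrite /ener !mulr_sumr -sumrB -big_split; apply: eq_bigr => f _ /=.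
  by rewrite !expr2; ring.
have : 0 <= \sum_f (ener phi psi * grad phi f - ener phi phi * grad psi f) ^+ 2.
  by apply: sumr_ge0 => f _; apply: sqr_ge0.
rewrite sq (_ : _ + _ = ener phi phi *
   (ener phi phi * ener psi psi - ener phi psi ^+ 2)); last by ring.
by rewrite pmulr_rge0 // subr_ge0.
Qed.

Lemma ntree_ge0 A : 0 <= ntree A. Proof. exact: ler0n. Qed.

Lemma ntree_sub A A' : A \subset A' -> ntree A' <= ntree A.
Proof.
move=> sA; rewrite ler_nat subset_leq_card //; apply/subsetP => T.
by rewrite !inE => /andP[-> /(subset_trans sA)].
Qed.

(** Cauchy-Schwarz for [tree_pot A e] against [psi]. By [ener_tree_pot] the self-energy of the
    potential is [ntree A * ntree (e |: A)], and one factor [ntree A] cancels. *)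
Lemma dirichlet A e psi : e \notin A -> {in A, forall f, grad psi f = 0} ->
  ntree A * grad psi e ^+ 2 <= ntree (e |: A) * ener psi psi.
Proof.
move=> eA flat; have [z|nz] := eqVneq (ntree A) 0.
  by rewrite z mul0r mulr_ge0 ?ntree_ge0 ?ener_ge0.
have pos : 0 < ntree A by rewrite lt_def nz ntree_ge0.
have := ener_CS (tree_pot A e) psi.
rewrite !ener_tree_pot //; last by move=> f; apply: tree_pot_flat.
by rewrite grad_tree_pot exprMn expr2 -!mulrA ler_pM2l.
Qed.

(** The potential for [g |: A] is flat on [A], so it is a test function in [dirichlet] for [A]. Its
    drop is [x] and its energy [ntree (g |: A) * x]; divide by [x]. *)
Lemma rayleigh A e g : e \notin A -> g \notin A -> e != g ->
  ntree A * ntree (e |: (g |: A)) <= ntree (e |: A) * ntree (g |: A).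
Proof.
move=> eA gA eg; set x := ntree (e |: (g |: A)).
have eB : e \notin g |: A by rewrite in_setU1 negb_or eg.
have flatB f : f \in g |: A -> grad (tree_pot (g |: A) e) f = 0.
  exact: tree_pot_flat.
have := @dirichlet A e (tree_pot (g |: A) e) eA.
rewrite ener_tree_pot // grad_tree_pot -/x => H.
have {}H := H (fun f fA => flatB f (setU1r _ fA)).
have [->|nz] := eqVneq x 0; first by rewrite mulr0 mulr_ge0 ?ntree_ge0.
have pos : 0 < x by rewrite lt_def nz ntree_ge0.
by move: H; rewrite expr2 !mulrA ler_pM2r.
Qed.
End Multigraph.

(** * Trace inequalities *)

Section Euclid.
Variable R : realFieldType.

Definition dot m (x y : 'cV[R]_m) : R := (x^T *m y) 0 0.
Definition nsq m (x : 'cV[R]_m) : R := dot x x.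

Section Dot.
Variable m : nat.
Implicit Types (x y z : 'cV[R]_m).

Lemma dotE x y : dot x y = \sum_i x i 0 * y i 0.
Proof. by rewrite /dot mxE; apply: eq_bigr => i _; rewrite mxE. Qed.

Lemma dotC x y : dot x y = dot y x.
Proof. by rewrite !dotE; apply: eq_bigr => i _; rewrite mulrC. Qed.

Lemma dotDr x y z : dot x (y + z) = dot x y + dot x z.
Proof. by rewrite /dot mulmxDr mxE. Qed.

Lemma dotZr a x y : dot x (a *: y) = a * dot x y.
Proof. by rewrite /dot -scalemxAr mxE. Qed.

Lemma dotNr x y : dot x (- y) = - dot x y.
Proof. by rewrite /dot mulmxN mxE. Qed.

Lemma dotBr x y z : dot x (y - z) = dot x y - dot x z.
Proof. by rewrite dotDr dotNr. Qed.

Lemma dot0r x : dot x 0 = 0.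
Proof. by rewrite /dot mulmx0 mxE. Qed.

Lemma dotDl x y z : dot (y + z) x = dot y x + dot z x.
Proof. by rewrite dotC dotDr !(dotC x). Qed.

Lemma dotZl a x y : dot (a *: y) x = a * dot y x.
Proof. by rewrite dotC dotZr (dotC x). Qed.

Lemma dotBl x y z : dot (y - z) x = dot y x - dot z x.
Proof. by rewrite dotC dotBr !(dotC x). Qed.

Lemma dot_sumr (I : Type) (r : seq I) (P : pred I) (F : I -> 'cV_m) x :
  dot x (\sum_(i <- r | P i) F i) = \sum_(i <- r | P i) dot x (F i).
Proof. by elim/big_rec2: _ => [|i y v _ <-]; rewrite ?dot0r ?dotDr. Qed.

Lemma dot_mulmx n (A : 'M_(m, n)) x (y : 'cV_n) :
  dot x (A *m y) = dot (A^T *m x) y.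
Proof. by rewrite /dot trmx_mul trmxK mulmxA. Qed.

Lemma nsq_ge0 x : 0 <= nsq x.
Proof. by rewrite /nsq dotE sumr_ge0 // => i _; rewrite -expr2 sqr_ge0. Qed.

Lemma nsq_eq0 x : (nsq x == 0) = (x == 0).
Proof.
apply/eqP/eqP => [|->]; last by rewrite /nsq dot0r.
rewrite /nsq dotE => /eqP; rewrite psumr_eq0; last first.
  by move=> i _; rewrite -expr2 sqr_ge0.
move=> /allP h; apply/matrixP => i j; rewrite ord1 mxE.
by have := h i; rewrite mem_index_enum mulf_eq0 orbb => /(_ isT)/eqP.
Qed.

Lemma nsqZ a x : nsq (a *: x) = a ^+ 2 * nsq x.
Proof. by rewrite /nsq dotZr dotZl mulrA. Qed.

Lemma nsqD x y : nsq (x + y) = nsq x + dot x y *+ 2 + nsq y.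
Proof. by rewrite /nsq !dotDr !dotDl (dotC y x); ring. Qed.

Lemma nsqB x y : nsq (x - y) = nsq x - dot x y *+ 2 + nsq y.
Proof. by rewrite nsqD dotNr /nsq dotNr (dotC (- y)) dotNr opprK mulNrn. Qed.

Lemma dot_le_nsq x y : dot x y *+ 2 <= nsq x + nsq y.
Proof. by have := nsq_ge0 (x - y); rewrite nsqB; lra. Qed.

Lemma CauchySchwarz x y : dot x y ^+ 2 <= nsq x * nsq y.
Proof.
have [/eqP->|nz] := boolP (x == 0).
  by rewrite dotC dot0r expr0n /= mulr_ge0 ?nsq_ge0.
have pos : 0 < nsq x by rewrite lt_def nsq_eq0 nz nsq_ge0.
have := nsq_ge0 (dot x y *: x - nsq x *: y).
rewrite nsqB !nsqZ dotZr dotZl (_ : _ + _ = nsq x * (nsq x * nsq y - dot x y ^+ 2)).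
  by rewrite pmulr_rge0 // subr_ge0.
by rewrite !expr2; ring.
Qed.

Lemma nsqB_le2 x y : nsq (x - y) <= 2 * nsq x + 2 * nsq y.
Proof. by have := nsq_ge0 (x + y); rewrite nsqD nsqB; lra. Qed.

End Dot.

Definition psd m (P : 'M[R]_m) := forall x, 0 <= dot x (P *m x).

Definition symm m (P : 'M[R]_m) := P^T = P.

(** From [0 <= P <= 1] follows [P^2 <= P]: evaluate the form of [P] at [x - P x]. *)
Lemma psd_sqr_le m (P : 'M[R]_m) x : symm P -> psd P ->
  (forall y, dot y (P *m y) <= nsq y) -> nsq (P *m x) <= dot x (P *m x).
Proof.
move=> sP pP leP; set y := P *m x.
have yy : dot x (P *m y) = nsq y by rewrite dot_mulmx sP.
have := pP (x - y); rewrite mulmxBr dotBr !dotBl -/y yy -/(nsq y).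
by have := leP y; lra.
Qed.

(** With [a = 1 / (N + 1)], [(1 + a) (1 - a / 2)^2 <= 1], while Bernoulli bounds the power of
    [1 - a / 2] below by one half. *)
Lemma exp1D_inv_le4 N : (1 + N.+1%:R^-1) ^+ N.+1 <= 4 :> R.
Proof.
set a := N.+1%:R^-1.
have a0 : 0 <= a by rewrite invr_ge0 ler0n.
have a1 : a <= 1 by rewrite invf_le1 ?ltr0n // ler1n.
have bern n : 1 - n%:R * (a / 2) <= (1 - a / 2) ^+ n.
  elim: n => [|n IH]; first by rewrite mul0r subr0 expr0.
  rewrite exprSr; apply: le_trans (ler_wpM2r _ IH); last lra.
  have : 0 <= n%:R * (a / 2) * (a / 2) :> R by rewrite !mulr_ge0 ?ler0n //; lra.
  by rewrite mulrS; lra.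
have half : 1 / 2 <= (1 - a / 2) ^+ N.+1.
  apply: le_trans (bern N.+1); rewrite mulrA mulfV ?pnatr_eq0 //; lra.
have b0 : 0 <= 1 - a / 2 by lra.
have le1 : ((1 + a) * (1 - a / 2) ^+ 2) ^+ N.+1 <= 1.
  apply: exprn_ile1; first by rewrite mulr_ge0 ?sqr_ge0 //; lra.
  have : 0 <= a ^+ 2 * (3 - a) by rewrite mulr_ge0 ?sqr_ge0 //; lra.
  by rewrite !expr2; lra.
move: le1; rewrite exprMn -exprM mulnC exprM => le1.
have : (1 + a) ^+ N.+1 * (1 / 2) ^+ 2 <= 1.
  apply: le_trans le1; rewrite ler_wpM2l ?exprn_ge0 //; first lra.
  by rewrite lerXn2r ?nnegrE //; lra.
by rewrite expr2; lra.
Qed.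

Section Trace.
Variable m : nat.
Implicit Types (A B C G M P Z : 'M[R]_m) (x y : 'cV[R]_m).

Lemma trE A B : \tr (A * B) = \sum_i \sum_k A i k * B k i.
Proof. by apply: eq_bigr => i _; rewrite mxE. Qed.

Lemma tr_sandwich P A : \tr (A^T * (P * A)) =
  \sum_i dot (col i A) (P *m col i A).
Proof.
apply: eq_bigr => i _; rewrite dotE mxE; apply: eq_bigr => k _.
by rewrite !mxE; congr (_ * _); apply: eq_bigr => l _; rewrite mxE.
Qed.

Lemma mul_tr_comm A B : \tr (A * B) = \tr (B * A).
Proof. exact: mxtrace_mulC. Qed.

Lemma trM_exp A B n : \tr ((A * B) ^+ n) = \tr ((B * A) ^+ n).
Proof.
case: n => [|n]; first by rewrite !expr0.
have -> : (A * B) ^+ n.+1 = A * ((B * A) ^+ n * B).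
  elim: n => [|n IH]; first by rewrite expr0 mul1r expr1.
  by rewrite exprS IH [(B * A) ^+ n.+1]exprS !mulrA.
by rewrite mul_tr_comm -mulrA -exprSr.
Qed.

Lemma trmxM A B : (A * B)^T = B^T * A^T.
Proof. exact: trmx_mul. Qed.

Lemma trmx_exp A n : (A ^+ n)^T = A^T ^+ n.
Proof.
elim: n => [|n IH]; first by rewrite !expr0; exact: trmx1.
by rewrite exprS exprSr trmxM IH.
Qed.

Lemma prod_pairs (F : nat -> 'M[R]_m) n :
  \prod_(0 <= i < n.*2) F i = \prod_(0 <= i < n) (F i.*2 * F i.*2.+1).
Proof.
elim: n => [|n IH]; first by rewrite !big_nil.
by rewrite doubleS !big_nat_recr //= IH mulrA.
Qed.

(* Hoelder's inequality for Schatten norms of dyadic exponent, with all norms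
   bounded by the same constant so that no roots are needed. *)
Lemma tr_prod_le j (F : nat -> 'M[R]_m) (tau : R) :
  (forall i, \tr ((F i * (F i)^T) ^+ (2 ^ j)) <= tau) ->
  `| \tr (\prod_(0 <= i < 2 ^ j.+1) F i) | <= tau.
Proof.
elim: j F tau => [|j IH] F tau H.
  rewrite expn1 !big_nat_recr //= big_nil mul1r.
  have := H 0%N; have := H 1%N; rewrite expn0 !expr1 !trE ler_norml.
  have E (G : 'M[R]_m) : \sum_i \sum_k G i k * (G^T) k i =
      \sum_i \sum_k G i k ^+ 2.
    by apply: eq_bigr => i _; apply: eq_bigr => k _; rewrite mxE expr2.
  have E' (G : 'M[R]_m) : \sum_i \sum_k G i k ^+ 2 = \sum_i \sum_k G k i ^+ 2.
    exact: exchange_big.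
  rewrite !E (E' (F 1%N)) => h1 h0.
  (* The base case is Cauchy-Schwarz for the Frobenius product, as a sum of squares for each
     sign. *)
  have pos (sg : R) : sg ^+ 2 = 1 -> 0 <= \sum_i \sum_k F 0%N i k ^+ 2
     + \sum_i \sum_k F 1%N k i ^+ 2 + 2 * sg * \sum_i \sum_k F 0%N i k * F 1%N k i.
    move=> sg2; rewrite mulr_sumr -!big_split; apply: sumr_ge0 => i _ /=.
    rewrite mulr_sumr -!big_split; apply: sumr_ge0 => k _ /=.
    rewrite (_ : _ + _ = (F 0%N i k + sg * F 1%N k i) ^+ 2) ?sqr_ge0 //.
    by rewrite sqrrD exprMn sg2; ring.
  have := pos 1 (expr1n _ _); have := pos (-1) (sqrr_sign _ 1).
  by move=> *; apply/andP; split; lra.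
rewrite [(2 ^ j.+2)%N]expnS mul2n prod_pairs; apply: (IH) => i.
set a := F _; set b := F _.
rewrite trmxM -!mulrA trM_exp.
(* After a cyclic rotation the power alternates [b * b^T] and [a^T * a]. It is again a product of
   [2 ^ j.+1] factors, so the induction hypothesis applies a second time. *)
pose L k := if odd k then a^T * a else b * b^T.
have -> : (b * (b^T * a^T) * a) ^+ (2 ^ j) = \prod_(0 <= k < 2 ^ j.+1) L k.
  rewrite expnS mul2n prod_pairs.
  rewrite (eq_bigr (fun _ => b * (b^T * a^T) * a)).
    by rewrite prodr_const_nat subn0.
  by move=> k _; rewrite /L /= odd_double /= !mulrA.
apply: (le_trans (ler_norm _)); apply: IH => k; rewrite /L; case: ifP => _.
  rewrite trmxM trmxK -expr2 -exprM -expnS trM_exp; exact: H.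
by rewrite trmxM trmxK -expr2 -exprM -expnS; exact: H.
Qed.

(** [tr_prod_le] with all factors equal to [A * B] replaces the square of [A * B] by
    [A * B * (A * B)^T]. Cyclicity turns this into [A^2 * B^2], and induction on [j] continues with
    the squares. *)
Lemma lieb_thirring j A B : symm A -> symm B ->
  \tr ((A * B) ^+ (2 ^ j)) <= \tr (A ^+ (2 ^ j) * B ^+ (2 ^ j)).
Proof.
elim: j A B => [|j IH] A B sA sB; first by rewrite expn0 !expr1.
apply: (@le_trans _ _ (\tr ((A * B * (A * B)^T) ^+ (2 ^ j)))).
  apply: le_trans (ler_norm _) _.
  rewrite -[in X in X <= _](subn0 (2 ^ j.+1)%N) -prodr_const_nat.
  exact: tr_prod_le.
rewrite trmxM sA sB -!mulrA trM_exp -!mulrA mulrA -expr2 -[A * A]expr2.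
rewrite trM_exp expnS !exprM; apply: IH; rewrite /symm trmx_exp ?sA ?sB //.
Qed.

Lemma dot_exp_le Z x k : (forall y, nsq (Z *m y) <= nsq y) ->
  nsq (Z ^+ k *m x) <= nsq x.
Proof.
move=> cZ; elim: k => [|k IH]; first by rewrite expr0 mul1mx.
by rewrite exprS -mulmxE -mulmxA (le_trans (cZ _)).
Qed.

Lemma exprZmx (a : R) Z k : (a *: Z) ^+ k = a ^+ k *: Z ^+ k.
Proof.
elim: k => [|k IH]; first by rewrite !expr0 scale1r.
by rewrite !exprS IH -!mulmxE -scalemxAl -scalemxAr scalerA.
Qed.

Lemma dot_exp_mid Z x k : symm Z -> (forall y, nsq (Z *m y) <= nsq y) ->
  dot x (Z ^+ k.+2 *m x) <= nsq (Z *m x).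
Proof.
move=> sZ cZ; rewrite exprS exprSr -!mulmxE -!mulmxA dot_mulmx sZ.
have := dot_le_nsq (Z *m x) (Z ^+ k *m (Z *m x)).
have := dot_exp_le (Z *m x) k cZ; lra.
Qed.

(* The matrix form of [(1 + z / N) ^ N <= 1 + z + 2 * z ^ 2] for [|z| <= 1]. *)
Lemma dot_exp1D_le Z x (N : nat) : symm Z ->
  (forall y, nsq (Z *m y) <= nsq y) -> (0 < N)%N ->
  dot x ((1 + N%:R^-1 *: Z) ^+ N *m x)
    <= nsq x + dot x (Z *m x) + 2 * nsq (Z *m x).
Proof.
case: N => // N sZ cZ _; have := exp1D_inv_le4 N; set a := N.+1%:R^-1 => le4.
have a0 : 0 <= a by rewrite invr_ge0 ler0n.
rewrite addrC exprD1n mulmx_suml dot_sumr.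
have aN : a * N.+1%:R = 1 by rewrite mulVf // pnatr_eq0.
have expand (b : 'I_N.+2 -> R) : \sum_(i < N.+2) b i =
    b ord0 + b (lift ord0 ord0) + \sum_(i < N) b (lift ord0 (lift ord0 i)).
  by rewrite !big_ord_recl addrA.
have term (i : 'I_N.+2) : dot x (((a *: Z) ^+ i *+ 'C(N.+1, i)) *m x) =
    (a ^+ i *+ 'C(N.+1, i)) * dot x (Z ^+ i *m x).
  by rewrite exprZmx -scaler_nat scalerA -!scalemxAl dotZr mulr_natl.
under eq_bigr do rewrite term.
rewrite expand /= expr0 mul1mx bin0 mulr1n mul1r -/(nsq x).
rewrite !expr1 bin1 -mulr_natr aN mul1r lerD2l.
(* The binomial weights sum to at most 4 and the first two equal 1. The terms of order at least two
   therefore have total weight at most 2, each bounded by [dot_exp_mid]. *)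
have : \sum_(i < N.+2) a ^+ i *+ 'C(N.+1, i) <= 4.
  by rewrite -exprD1n addrC.
rewrite expand /= expr0 bin0 mulr1n expr1 bin1 -mulr_natr aN => sum_le.
apply: (@le_trans _ _ ((\sum_(i < N) a ^+ i.+2 *+ 'C(N.+1, i.+2)) * nsq (Z *m x))).
  rewrite mulr_suml; apply: ler_sum => i _.
  rewrite ler_wpM2l ?mulrn_wge0 ?exprn_ge0 //.
  exact: dot_exp_mid.
rewrite ler_wpM2r ?nsq_ge0 //; move: sum_le.
by rewrite /bump /=; lra.
Qed.

(** An even power lets cyclicity place [G ^+ q] on both sides of [P], so the trace is a sum of
    quadratic forms over columns. *)
Lemma tr_psd_le P G (a : R) q : symm G ->
  (forall x, dot x (P *m x) <= a * nsq x) ->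
  \tr (P * G ^+ (q + q)) <= a * \tr (G ^+ (q + q)).
Proof.
move=> sG leP; have sGq : (G ^+ q)^T = G ^+ q by rewrite trmx_exp sG.
rewrite exprD mulrA mul_tr_comm -{1}sGq tr_sandwich.
have -> : \tr (G ^+ q * G ^+ q) = \tr ((G ^+ q)^T * (1 * G ^+ q)).
  by rewrite sGq mul1r.
rewrite tr_sandwich mulr_sumr.
by apply: ler_sum => i _; rewrite mul1mx; apply: leP.
Qed.

Lemma nsq_mul_le_tr A x : nsq (A *m x) <= \tr (A * A^T) * nsq x.
Proof.
have -> : \tr (A * A^T) = \sum_i nsq (row i A)^T.
  rewrite trE; apply: eq_bigr => i _; rewrite /nsq dotE.
  by apply: eq_bigr => k _; rewrite !mxE.
rewrite {1}/nsq dotE mulr_suml; apply: ler_sum => i _.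
rewrite -expr2 (_ : (A *m x) i 0 = dot (row i A)^T x) ?CauchySchwarz //.
by rewrite dotE mxE; apply: eq_bigr => k _; rewrite !mxE.
Qed.

(** Stands in for bounding the top eigenvalue by the trace. A lower bound on the Rayleigh quotient
    at [x] is squared along with the matrix, by Cauchy-Schwarz; the last squaring is compared with
    the Frobenius norm. *)
Lemma exp_le_tr A x (h : R) j : symm A -> x != 0 -> 0 <= h ->
  h * nsq x <= dot x (A *m x) -> h ^+ (2 ^ j.+1) <= \tr (A ^+ (2 ^ j.+1)).
Proof.
move=> sA x0 h0 le_h.
have pos : 0 < nsq x by rewrite lt_def nsq_eq0 x0 nsq_ge0.
have sAj k : (A ^+ k)^T = A ^+ k by rewrite trmx_exp sA.
have sq B (b : R) : 0 <= b -> b * nsq x <= dot x (B *m x) ->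
    b ^+ 2 * nsq x <= nsq (B *m x).
  move=> b0 le_b; have := CauchySchwarz x (B *m x).
  have : (b * nsq x) ^+ 2 <= dot x (B *m x) ^+ 2.
    by rewrite lerXn2r ?nnegrE ?mulr_ge0 ?nsq_ge0 // (le_trans _ le_b) ?mulr_ge0 ?nsq_ge0.
  move=> h1 h2; rewrite -(ler_pM2l pos); apply: le_trans (le_trans h1 h2).
  by rewrite le_eqVlt; apply/orP; left; apply/eqP; ring.
have iter : h ^+ (2 ^ j) * nsq x <= dot x (A ^+ (2 ^ j) *m x).
  elim: j => [|j IH]; first by rewrite expn0 !expr1.
  have := sq _ _ (exprn_ge0 _ h0) IH.
  by rewrite -exprM -expnSr /nsq -{1}sAj -dot_mulmx mulmxA mulmxE -expr2 -exprM -expnSr.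
have := le_trans (sq _ _ (exprn_ge0 _ h0) iter) (nsq_mul_le_tr _ _).
by rewrite ler_pM2r // sAj -expr2 -!exprM -expnSr.
Qed.

End Trace.

Lemma nsq_tr_le m (A : 'M[R]_m) (c : R) : 0 <= c ->
  (forall y, nsq (A^T *m y) <= c * nsq y) -> forall y, nsq (A *m y) <= c * nsq y.
Proof.
move=> c0 leA y; set z := A *m y.
have [->|z0] := eqVneq (nsq z) 0; first by rewrite mulr_ge0 ?nsq_ge0.
have pos : 0 < nsq z by rewrite lt_def z0 nsq_ge0.
have E : nsq z = dot y (A^T *m z) by rewrite dot_mulmx trmxK.
have := CauchySchwarz y (A^T *m z); rewrite -E => H.
rewrite -(ler_pM2r pos) -expr2; apply: le_trans H _.
rewrite mulrAC mulrC ler_wpM2r ?nsq_ge0 //; exact: leA.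
Qed.

End Euclid.

(** * Cholesky factorisation of positive definite matrices *)

Section Cholesky.
Variable R : rcfType.

Lemma cholesky n (H : 'M[R]_n) : symm H ->
  (forall x : 'cV_n, x != 0 -> 0 < dot x (H *m x)) -> exists K : 'M[R]_n, K *m K^T = H.
Proof.
elim: n H => [|n IH] H sH pH; first by exists 0; apply/matrixP => -[].
pose H1 : 'M_(1 + n) := H; have sH1 : H1^T = H1 := sH.
have pH1 (x : 'cV_(1 + n)) : x != 0 -> 0 < dot x (H1 *m x) by apply: pH.
pose a := H1 (lshift n 0) (lshift n 0); pose r := ursubmx H1; pose D := drsubmx H1.
have defH : H1 = block_mx a%:M r r^T D.
  rewrite -[LHS]submxK; congr block_mx.
    by rewrite [LHS]mx11_scalar !mxE.
  by rewrite /r trmx_ursub sH1.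
have dot_col (c : R) (y : 'cV_n) (p : 'cV_1) (q : 'cV_n) :
    dot (col_mx c%:M y) (col_mx p q) = c * p 0 0 + dot y q.
  by rewrite /dot tr_col_mx mul_row_col tr_scalar_mx mul_scalar_mx !mxE.
have form (c : R) (y : 'cV_n) : dot (col_mx c%:M y) (H1 *m col_mx c%:M y) =
    a * c ^+ 2 + c * (r *m y) 0 0 *+ 2 + dot y (D *m y).
  rewrite defH mul_block_col dot_col dotDr mul_scalar_mx mul_mx_scalar dotZr.
  have -> : dot y r^T = (r *m y) 0 0.
    by rewrite dotE mxE; apply: eq_bigr => i _; rewrite mxE mulrC.
  by rewrite [(_ + _ : 'M_(1,1)) _ _]mxE !mxE eqxx mulr1n; ring.
have a_gt0 : 0 < a.
  have := pH1 (col_mx 1%:M 0); rewrite form !mulmx0 dot0r mxE.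
  rewrite expr1n !mulr1 mulr0 mul0rn !addr0; apply.
  apply: contraTneq isT => /matrixP/(_ (lshift n 0) 0).
  by rewrite col_mxEu !mxE eqxx => /eqP; rewrite oner_eq0.
have [| |K' defK'] := IH (D - a^-1 *: (r^T *m r)).
- rewrite /symm linearB linearZ /= trmx_mul trmxK; congr (_ - _).
  by rewrite /D trmx_drsub sH1.
(* This [c] minimises the form over the first coordinate, so the value there is the form of the
   Schur complement. *)
- move=> y y0; pose c := - (a^-1 * (r *m y) 0 0).
  have := pH1 (col_mx c%:M y); rewrite form.
  have -> : dot y ((D - a^-1 *: (r^T *m r)) *m y) =
     dot y (D *m y) - a^-1 * (r *m y) 0 0 ^+ 2.
    rewrite mulmxBl dotBr -scalemxAl dotZr -mulmxA [dot y (r^T *m _)]dot_mulmx trmxK.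
    by rewrite [dot (r *m y) _]dotE big_ord1 expr2.
  rewrite (_ : _ + _ = dot y (D *m y) - a^-1 * (r *m y) 0 0 ^+ 2); last first.
    by rewrite /c; field; rewrite gt_eqF.
  apply; apply: contraNneq y0 => /(congr1 (@dsubmx _ 1 n 1)).
  by rewrite col_mxKd linear0 => ->.
pose al := Num.sqrt a.
have al2 : al * al = a by rewrite -expr2 sqr_sqrtr // ltW.
have al0 : al != 0 by rewrite gt_eqF // sqrtr_gt0.
pose B : 'M_(1 + n) := block_mx al%:M 0 (al^-1 *: r^T) K'.
exists B; change (B *m B^T = H1); rewrite defH /B tr_block_mx trmx0 mulmx_block; congr block_mx.
- by rewrite tr_scalar_mx mul_scalar_mx scale_scalar_mx al2 mul0mx addr0.
- rewrite linearZ /= trmxK mul_scalar_mx scalerA mulfV // scale1r mul0mx addr0 //.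
- rewrite tr_scalar_mx mul_mx_scalar scalerA mulfV // scale1r mulmx0 addr0 //.
- rewrite linearZ /= trmxK -scalemxAl -scalemxAr scalerA -invfM al2 defK'.
  by rewrite addrC subrK.
Qed.
Lemma cholesky_unit n (H : 'M[R]_n) : symm H ->
  (forall x : 'cV_n, x != 0 -> 0 < dot x (H *m x)) ->
  exists2 K : 'M[R]_n, K *m K^T = H & K \in unitmx.
Proof.
move=> sH pH; have [K defK] := cholesky sH pH; exists K => //.
rewrite -row_free_unit -kermx_eq0; apply/rowV0P => v /sub_kermxP vK.
apply/eqP; rewrite -trmx_eq0; apply: contraT => /pH.
by rewrite -defK -mulmxA -trmx_mul vK trmx0 mulmx0 dot0r ltxx.
Qed.

End Cholesky.

(** * One random increment in the trace moment *)

Section Step.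
Variable R : rcfType.

(* With [H = K K^T], the perturbed matrix is [K (1 + (theta / N) Y) K^T] with
   [Y = K^-1 X K^-T], and Lieb-Thirring separates the two factors. *)
Lemma one_step m (I : finType) (P : pred I) (w : I -> R) (X : I -> 'M[R]_m)
    (H : 'M[R]_m) (theta sigma : R) j :
  (forall i, P i -> 0 <= w i) -> \sum_(i | P i) w i = 1 ->
  (forall i, P i -> symm (X i)) ->
  (forall i x, P i -> nsq (X i *m x) <= 4 * nsq x) ->
  (forall x, \sum_(i | P i) w i * dot x (X i *m x) = 0) ->
  (forall x, \sum_(i | P i) w i * nsq (X i *m x) <= sigma * nsq x) ->
  symm H -> (forall x, nsq x <= 2 * dot x (H *m x)) ->
  0 <= sigma -> theta ^+ 2 <= 1 / 16 ->
  \sum_(i | P i) w i * \tr ((H + (theta / (2 ^ j.+1)%:R) *: X i) ^+ (2 ^ j.+1))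
    <= (1 + 8 * theta ^+ 2 * sigma) * \tr (H ^+ (2 ^ j.+1)).
Proof.
move=> w0 w1 sX X4 Xmean Xvar sH Hge sigma0 th; set N := (2 ^ j.+1)%N.
have N0 : (0 < N)%N by rewrite expn_gt0.
have [|K defK uK] := cholesky_unit sH.
  move=> x x0; have : 0 < nsq x by rewrite lt_def nsq_eq0 x0 nsq_ge0.
  by have := Hge x; lra.
pose Ki := invmx K.
have KiT y : nsq (Ki^T *m y) <= 2 * nsq y.
  have := Hge (Ki^T *m y); rewrite -defK -mulmxA dot_mulmx.
  by rewrite mulmxA -trmx_mul mulVmx // trmx1 mul1mx.
have Ki2 y : nsq (Ki *m y) <= 2 * nsq y by apply: nsq_tr_le KiT y.
pose Z i := theta *: (Ki *m X i *m Ki^T).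
have ZE i y : Z i *m y = theta *: (Ki *m (X i *m (Ki^T *m y))).
  by rewrite /Z -scalemxAl !mulmxA.
have sZ i : P i -> symm (Z i).
  by move=> Pi; rewrite /symm /Z linearZ /= !trmx_mul trmxK sX // mulmxA.
(* Each factor [K^-1], [K^-T] costs 2 and [X i] costs 4, so [Z i] is a contraction as soon as
   [16 * theta ^+ 2 <= 1]. *)
have cZ i y : P i -> nsq (Z i *m y) <= nsq y.
  move=> Pi; rewrite ZE nsqZ.
  have h1 := Ki2 (X i *m (Ki^T *m y)); have h2 := X4 i (Ki^T *m y) Pi.
  have h3 := KiT y.
  apply: le_trans (ler_wpM2l (sqr_ge0 _) (_ : _ <= 16 * nsq y)) _; first lra.
  by have := ler_wpM2r (nsq_ge0 y) th; lra.
pose C i := 1 + N%:R^-1 *: Z i.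
pose G := K^T *m K.
have sG : symm G by rewrite /symm /G trmx_mul trmxK.
have trK (D : 'M[R]_m) n : \tr ((K *m D *m K^T) ^+ n) = \tr ((D * G) ^+ n).
  by rewrite !mulmxE -mulrA trM_exp -mulrA.
have trH : \tr (H ^+ N) = \tr (G ^+ N).
  by rewrite -defK -[K in K *m _]mulmx1 trK mul1r.
have HX i : H + (theta / N%:R) *: X i = K *m C i *m K^T.
  rewrite /C mulmxDr mulmxDl mulmx1 defK; congr (_ + _).
  rewrite /Z scalerA -scalemxAr -scalemxAl mulrC; congr (_ *: _).
  rewrite !mulmxA mulmxV // mul1mx -mulmxA -trmx_mul mulmxV // trmx1 mulmx1 //.
apply: (@le_trans _ _ (\tr ((\sum_(i | P i) w i *: C i ^+ N) * G ^+ N))).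
  rewrite mulr_suml raddf_sum /=; apply: ler_sum => i Pi.
  rewrite (_ : w i *: C i ^+ N * G ^+ N = w i *: (C i ^+ N * G ^+ N)); last exact/esym/scalemxAl.
  rewrite mxtraceZ ler_wpM2l ?w0 // HX trK.
  apply: lieb_thirring => //.
  by rewrite /symm /C linearD linearZ /= sZ // trmx1.
have NN : N = (2 ^ j + 2 ^ j)%N by rewrite /N expnS mul2n addnn.
rewrite trH NN; apply: tr_psd_le => // x; rewrite -NN.
rewrite mulmx_suml dot_sumr.
apply: (@le_trans _ _ (\sum_(i | P i) w i * (nsq x + dot x (Z i *m x) +
    2 * nsq (Z i *m x)))).
  apply: ler_sum => i Pi; rewrite -scalemxAl dotZr ler_wpM2l ?w0 //.
  apply: dot_exp1D_le => //; first exact: sZ.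
  by move=> y; apply: cZ.
have E i : w i * (nsq x + dot x (Z i *m x) + 2 * nsq (Z i *m x)) =
    w i * nsq x + theta * (w i * dot (Ki^T *m x) (X i *m (Ki^T *m x)))
    + 2 * (w i * nsq (Z i *m x)).
  by rewrite {1}ZE dotZr [dot x _]dot_mulmx; ring.
rewrite (eq_bigr _ (fun i _ => E i)) !big_split /= -mulr_suml -!mulr_sumr w1 Xmean.
rewrite mul1r mulr0 addr0 [leRHS]mulrDl mul1r lerD2l.
(* The 8 of the conclusion is the 2 of [dot_exp1D_le] times a 2 from each of [K^-1] and [K^-T]. *)
have : \sum_(i | P i) w i * nsq (Z i *m x) <=
   \sum_(i | P i) theta ^+ 2 * 2 * (w i * nsq (X i *m (Ki^T *m x))).
  apply: ler_sum => i Pi; rewrite ZE nsqZ mulrCA -mulrA ler_wpM2l ?sqr_ge0 //.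
  by rewrite mulrCA ler_wpM2l ?w0.
rewrite -mulr_sumr; have := sqr_ge0 theta; move: (theta ^+ 2) => u u0 h.
have h1 : \sum_(i | P i) w i * nsq (X i *m (Ki^T *m x)) <= sigma * (2 * nsq x).
  by apply: le_trans (Xvar _) _; rewrite ler_wpM2l.
have := ler_wpM2l u0 h1; lra.
Qed.
End Step.

(** * The edge exposure martingale *)

(** Here [theta] is at most 1/4 in absolute value. The lemma limits how far one increment can lower
    the quadratic form of [H]. *)
Lemma small_mul_ge (F : realFieldType) (theta d b : F) :
  theta ^+ 2 <= 1 / 16 -> d <= 2 * b -> - (2 * b) <= d -> - (1 / 2 * b) <= theta * d.
Proof.
move=> th d1 d2; have b0 : 0 <= b by lra.
have th2 : theta <= 1 / 4.
  by rewrite leNgt; apply/negP => h; move: th; rewrite expr2; nra.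
have th1 : - (1 / 4) <= theta.
  by rewrite leNgt; apply/negP => h; move: th; rewrite expr2; nra.
have h1 : 0 <= (1 / 4 + theta) * (2 * b + d) by rewrite mulr_ge0 //; lra.
have h2 : 0 <= (1 / 4 - theta) * (2 * b - d) by rewrite mulr_ge0 //; lra.
by lra.
Qed.

Section Martingale.
Variables (R : rcfType) (V X : finType) (s t : X -> V).
Hypothesis has_tree : exists T, is_tree s t T.
Implicit Types (A T : {set X}) (c e : X).

Local Notation N := (ntree s t R).
Local Notation tree := (is_tree s t).

Let k := (#|V| - 1)%N.

(** The chance that a uniform tree containing [A] contains [c]; it is 0 by convention when no tree
    contains [A]. For empty [A] it is the inverse effective conductance. *)
Definition cond_prob A c : R := N (c |: A) / N A.

Lemma card_treeE T : tree T -> #|T| = k.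
Proof.
move=> tT; have [r _|V0] := pickP (@predT V); first exact: (card_tree R r tT).
(* Without vertices there are no edges, and truncated subtraction makes [k] zero. *)
have V0' : #|V| = 0%N by apply: eq_card0 => v; exact: V0.
rewrite /k V0'; apply: eq_card0 => c.
by have := V0 (s c).
Qed.

Lemma ntree0_gt0 : 0 < N set0.
Proof.
by have [T tT] := has_tree; rewrite ltr0n; apply/card_gt0P; exists T;
  rewrite inE tT sub0set.
Qed.

Lemma ntree_eq0 A T : N A = 0 -> tree T -> A \subset T = false.
Proof.
move=> /eqP; rewrite pnatr_eq0 cards_eq0 => /eqP/setP/(_ T).
by rewrite !inE => H tT; rewrite tT in H.
Qed.

(** Double counting: a tree through [A] is met once for each of its [k - #|A|] edges outside [A]. *)
Lemma sum_add_edge A (g : {set X} -> R) :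
  \sum_(e | e \notin A) \sum_(T | tree T && (e |: A \subset T)) g T =
  \sum_(T | tree T && (A \subset T)) (k - #|A|)%:R * g T.
Proof.
rewrite (exchange_big_dep (fun T => tree T && (A \subset T))) /=; last first.
  by move=> e T _; rewrite subUset => /and3P[-> _ ->].
apply: eq_bigr => T /andP[tT AT]; rewrite sumr_const -[LHS]mulr_natl.
rewrite -(card_treeE tT) [#|A|](_ : _ = #|T :&: A|); last first.
  by rewrite (setIidPr AT).
rewrite -cardsD; congr (_%:R * _).
apply: eq_card => e; rewrite !inE unfold_in /= tT subUset sub1set AT andbT.
by rewrite andbC.
Qed.

Lemma ntree_add A c :
  N (c |: A) = \sum_(T | tree T && (A \subset T)) (c \in T)%:R.
Proof.
rewrite ntreeE (eq_bigl (fun T => (tree T && (A \subset T)) && (c \in T))).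
  by rewrite big_mkcondr; apply: eq_bigr => T _; case: (c \in T).
by move=> T; rewrite subUset sub1set -andbA [(A \subset T) && _]andbC.
Qed.

Lemma sum_ntree_add A c : \sum_(e | e \notin A) N (c |: (e |: A)) =
  (k - #|A|)%:R * N (c |: A).
Proof.
under eq_bigr do rewrite ntree_add.
by rewrite sum_add_edge -mulr_sumr ntree_add.
Qed.

Lemma cond_prob_in A c : N A != 0 -> c \in A -> cond_prob A c = 1.
Proof.
move=> nz cA; rewrite /cond_prob (_ : c |: A = A) ?divff //.
by apply/setUidPr; rewrite sub1set.
Qed.

Lemma cond_prob_ge0 A c : 0 <= cond_prob A c.
Proof. by rewrite divr_ge0 ?ntree_ge0. Qed.

Lemma cond_prob_add A c e : c \notin A -> e \notin A -> c != e ->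
  cond_prob (e |: A) c <= cond_prob A c.
Proof.
move=> cA eA ce; rewrite /cond_prob.
have [->|nz] := eqVneq (N (e |: A)) 0.
  by rewrite invr0 mulr0; apply: cond_prob_ge0.
have pos : 0 < N (e |: A) by rewrite lt_def nz ntree_ge0.
have posA : 0 < N A by apply: lt_le_trans pos (ntree_sub _ _ _ (subsetUr _ _)).
rewrite ler_pdivrMr // mulrAC ler_pdivlMr // mulrC.
exact: rayleigh.
Qed.

(** Remove the edges of [A] one at a time, using negative correlation in the form
    [cond_prob_add]. *)
Lemma cond_prob_le A c : c \notin A -> cond_prob A c <= cond_prob set0 c.
Proof.
elim: {A}#|A| {-2}A (erefl #|A|) => [|n IH] A.
  by move/eqP; rewrite cards_eq0 => /eqP->.
move=> cardA cA; have /card_gt0P[e eA] : (0 < #|A|)%N by rewrite cardA.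
rewrite -(setD1K eA); apply: (@le_trans _ _ (cond_prob (A :\ e) c)).
  apply: cond_prob_add; first by rewrite in_setD1 (negbTE cA) andbF.
    by rewrite setD11.
  by apply: contraNneq cA => ->.
apply: IH; first by move: cardA; rewrite (cardsD1 e) eA add1n => -[].
by rewrite !inE (negbTE cA) andbF.
Qed.

(** Coordinates, supplied later by [grad_basis], in which the Laplacian is the identity: a vector
    [x] encodes a potential modulo constants on components, and pairing with [a c] gives its drop
    across [c]. *)
Variables (m : nat) (a : X -> 'cV[R]_m).
Hypothesis parseval : forall x, \sum_c dot (a c) x ^+ 2 = nsq x.
Hypothesis a_grad : forall x, exists phi, forall c, grad s t phi c = dot (a c) x.

(* In the coordinates where the Laplacian is the identity, the Laplacian of [c]
   weighted by its effective conductance. *)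
Definition edge_mx c : 'M[R]_m := (cond_prob set0 c)^-1 *: (a c *m (a c)^T).

Local Notation Y := edge_mx.

Lemma edge_mx_dot c x : dot x (Y c *m x) = (cond_prob set0 c)^-1 * dot (a c) x ^+ 2.
Proof.
rewrite /edge_mx -scalemxAl dotZr -mulmxA dot_mulmx; congr (_ * _).
by rewrite dotE big_ord1 expr2.
Qed.

Lemma edge_dirichlet c x : dot (a c) x ^+ 2 <= cond_prob set0 c * nsq x.
Proof.
have [phi phiE] := a_grad x.
have := @dirichlet _ _ s t R set0 c phi; rewrite in_set0 phiE => /(_ isT).
rewrite /cond_prob mulrAC ler_pdivlMr ?ntree0_gt0 // mulrC => H.
apply: le_trans (H _) _; first by move=> f; rewrite in_set0.
suff -> : ener s t phi phi = nsq x by [].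
by rewrite -parseval; apply: eq_bigr => f _; rewrite phiE expr2.
Qed.

(** All matrices of the martingale have this form, so their symmetry and order bounds are read off
    the coefficients. *)
Definition comb (d : X -> R) : 'M[R]_m := \sum_c d c *: Y c.

Lemma comb_symm d : symm (comb d).
Proof.
rewrite /symm /comb raddf_sum; apply: eq_bigr => c _ /=.
by rewrite linearZ /= /edge_mx linearZ /= trmx_mul trmxK.
Qed.

Lemma comb_dot d x : dot x (comb d *m x) = \sum_c d c * dot x (Y c *m x).
Proof.
rewrite /comb mulmx_suml dot_sumr; apply: eq_bigr => c _.
by rewrite -scalemxAl dotZr.
Qed.

Lemma comb_psd d : (forall c, 0 <= d c) -> psd (comb d).
Proof.
move=> d0 x; rewrite comb_dot sumr_ge0 // => c _.
by rewrite edge_mx_dot mulr_ge0 // mulr_ge0 ?sqr_ge0 // invr_ge0 cond_prob_ge0.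
Qed.

Lemma comb_le1 d x : (forall c, d c <= cond_prob set0 c) ->
  dot x (comb d *m x) <= nsq x.
Proof.
move=> dl; rewrite comb_dot -parseval; apply: ler_sum => c _.
rewrite edge_mx_dot; have [->|nz] := eqVneq (cond_prob set0 c) 0.
  by rewrite invr0 mul0r mulr0 sqr_ge0.
have pos : 0 < cond_prob set0 c by rewrite lt_def nz cond_prob_ge0.
by rewrite mulrA ler_piMl ?sqr_ge0 // ler_pdivrMr // mul1r.
Qed.

(** The mean of [M_T] is the Laplacian, here the identity. An edge in no tree has coefficient 0, and
    [edge_dirichlet] makes its drop vanish as well. *)
Lemma comb1_dot x : dot x (comb (cond_prob set0) *m x) = nsq x.
Proof.
rewrite comb_dot -parseval; apply: eq_bigr => c _; rewrite edge_mx_dot.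
have [z|nz] := eqVneq (cond_prob set0 c) 0; last by rewrite mulVKf.
apply/eqP; rewrite z mul0r eq_sym eq_le sqr_ge0 andbT.
by apply: le_trans (edge_dirichlet c x) _; rewrite z mul0r.
Qed.

Lemma combB d d' : comb d - comb d' = comb (fun c => d c - d' c).
Proof. by rewrite /comb -sumrB; apply: eq_bigr => c _; rewrite scalerBl. Qed.

Lemma comb_edge e : comb (fun c => (c == e)%:R) = Y e.
Proof.
rewrite /comb (bigD1 e) //= eqxx scale1r big1 ?addr0 // => c /negbTE->.
by rewrite scale0r.
Qed.

Lemma edge_mx_le1 e x : dot x (Y e *m x) <= nsq x.
Proof.
rewrite edge_mx_dot; have [->|nz] := eqVneq (cond_prob set0 e) 0.
  by rewrite invr0 mul0r nsq_ge0.
have pos : 0 < cond_prob set0 e by rewrite lt_def nz cond_prob_ge0.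
by rewrite mulrC ler_pdivrMr // mulrC; apply: edge_dirichlet.
Qed.

Definition cond_mean A := comb (cond_prob A).

Section Increment.
Variable A : {set X}.
Hypothesis NA : N A != 0.
Variable e : X.
Hypotheses (eA : e \notin A) (Ne : N (e |: A) != 0).

(** Coefficients of the loss. The gain is the full [Y e], so at [c = e] the added 1 leaves
    [cond_prob A e]. *)
Let d c := cond_prob A c - cond_prob (e |: A) c + (c == e)%:R.

Lemma incrE : cond_mean (e |: A) - cond_mean A = Y e - comb d.
Proof.
rewrite -comb_edge !combB /comb; apply: eq_bigr => c _; congr (_ *: _).
by rewrite /d; ring.
Qed.

Lemma loss_bounds c : 0 <= d c <= cond_prob set0 c.
Proof.
rewrite /d; have [->|ce] := eqVneq c e.
  rewrite (cond_prob_in Ne) ?setU11 // subrK cond_prob_ge0 /=.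
  exact: cond_prob_le.
have [cA|cA] := boolP (c \in A).
  rewrite (cond_prob_in NA cA) (cond_prob_in Ne) ?in_setU1 ?cA ?orbT //.
  by rewrite subrr addr0 lexx cond_prob_ge0.
rewrite addr0 subr_ge0 cond_prob_add //= lerBlDr ler_wpDr ?cond_prob_ge0 //.
exact: cond_prob_le.
Qed.

(** Gain and loss both lie between 0 and the identity, so [psd_sqr_le] bounds their squares by
    themselves. The bound is linear in both, so variances reduce to means. *)
Lemma nsq_incr x : nsq ((cond_mean (e |: A) - cond_mean A) *m x) <=
  2 * dot x (Y e *m x) + 2 * dot x (comb d *m x).
Proof.
rewrite incrE mulmxBl; apply: le_trans (nsqB_le2 _ _) _.
have h1 : nsq (Y e *m x) <= dot x (Y e *m x).
  apply: psd_sqr_le; last exact: edge_mx_le1.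
  - by rewrite -comb_edge; apply: comb_symm.
  - by rewrite -comb_edge; apply: comb_psd => c; rewrite ler0n.
have h2 : nsq (comb d *m x) <= dot x (comb d *m x).
  apply: psd_sqr_le; first exact: comb_symm.
  - by apply: comb_psd => c; have /andP[] := loss_bounds c.
  - by move=> y; apply: comb_le1 => c; have /andP[] := loss_bounds c.
lra.
Qed.

Lemma nsq_incr_le4 x : nsq ((cond_mean (e |: A) - cond_mean A) *m x) <= 4 * nsq x.
Proof.
apply: le_trans (nsq_incr x) _.
have := edge_mx_le1 e x.
have : dot x (comb d *m x) <= nsq x.
  by apply: comb_le1 => c; have /andP[] := loss_bounds c.
lra.
Qed.

Lemma loss_dot x : dot x (comb d *m x) =
  dot x (Y e *m x) - dot x ((cond_mean (e |: A) - cond_mean A) *m x).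
Proof. by rewrite incrE mulmxBl dotBr opprB addrC subrK. Qed.

End Increment.

Lemma cond_prob_mul A c : N A * cond_prob A c = N (c |: A).
Proof.
rewrite /cond_prob; have [z|nz] := eqVneq (N A) 0; last by rewrite mulrC mulfVK.
rewrite z mul0r; apply/esym/eqP; rewrite eq_le ntree_ge0 andbT -[leRHS]z.
by rewrite ntree_sub ?subsetUr.
Qed.

Lemma sum_ntree_edges A : \sum_(e | e \notin A) N (e |: A) = (k - #|A|)%:R * N A.
Proof.
under eq_bigr do rewrite ntreeE.
by rewrite sum_add_edge -mulr_sumr -ntreeE.
Qed.

Section Step.
Variables (A : {set X}) (r : nat).
Hypotheses (NA : N A != 0) (cardA : (#|A| + r.+1)%N = k).

(** The law of the next exposed edge: uniform among the [r.+1] hidden edges of a random tree through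
    [A]. *)
Let w e := cond_prob A e / r.+1%:R.
Let P e := (e \notin A) && (N (e |: A) != 0).

Let kA : (k - #|A|)%N = r.+1. Proof. by rewrite -cardA addKn. Qed.

Let w_ge0 e : 0 <= w e.
Proof. by rewrite divr_ge0 ?cond_prob_ge0. Qed.

Let wE e : w e = N (e |: A) / (r.+1%:R * N A).
Proof. by rewrite /w /cond_prob invfM mulrA mulrAC. Qed.

Let sum_P (F : X -> R) : \sum_(e | P e) w e * F e = \sum_(e | e \notin A) w e * F e.
Proof.
rewrite [RHS](bigID (fun e => N (e |: A) != 0)) /= [X in _ = _ + X]big1 ?addr0 //.
by move=> e /andP[_ /negPn/eqP z]; rewrite wE z !mul0r.
Qed.

Let w_sum1 : \sum_(e | P e) w e = 1.
Proof.
under eq_bigr do rewrite -[w _]mulr1.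
rewrite sum_P; under eq_bigr do rewrite mulr1 wE.
by rewrite -mulr_suml sum_ntree_edges kA divff // mulf_neq0 // pnatr_eq0.
Qed.

(** The martingale property; both averages of [Y c] reduce to counts of trees through [c |: A], by
    [sum_ntree_add]. *)
Let w_mean x : \sum_(e | P e) w e *
  dot x ((cond_mean (e |: A) - cond_mean A) *m x) = 0.
Proof.
rewrite sum_P; pose y c := dot x (Y c *m x).
have E e : w e * dot x ((cond_mean (e |: A) - cond_mean A) *m x) =
   (r.+1%:R * N A)^-1 * (\sum_c N (c |: (e |: A)) * y c
     - N (e |: A) * \sum_c cond_prob A c * y c).
  rewrite wE [N _ / _]mulrC -mulrA mulmxBl dotBr !comb_dot mulrBr; congr (_ * (_ - _)).
  by rewrite mulr_sumr; apply: eq_bigr => c _; rewrite mulrA cond_prob_mul.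
under eq_bigr do rewrite E.
rewrite -mulr_sumr sumrB -mulr_suml sum_ntree_edges exchange_big /= kA.
rewrite (_ : _ - _ = 0) ?mulr0 //; apply/eqP; rewrite subr_eq0; apply/eqP.
rewrite mulr_sumr; apply: eq_bigr => c _.
by rewrite -mulr_suml sum_ntree_add kA -(cond_prob_mul A c) !mulrA.
Qed.

(** Increments have mean zero, so loss and gain have equal means and [nsq_incr] gives four times the
    mean gain. By [cond_prob_le] that mean is at most the identity over [r.+1]. *)
Let w_var x : \sum_(e | P e) w e *
  nsq ((cond_mean (e |: A) - cond_mean A) *m x) <= 4 / r.+1%:R * nsq x.
Proof.
pose y c := dot x (Y c *m x).
apply: (@le_trans _ _ (\sum_(e | P e) (4 * (w e * y e)
   - 2 * (w e * dot x ((cond_mean (e |: A) - cond_mean A) *m x))))).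
  apply: ler_sum => e /andP[eA Ne]; have := nsq_incr NA eA Ne x.
  rewrite loss_dot -/(y e) => H.
  by apply: le_trans (ler_wpM2l (w_ge0 e) H) _; lra.
rewrite sumrB -!mulr_sumr w_mean mulr0 subr0 sum_P -mulrA ler_wpM2l //.
pose d e := if e \notin A then cond_prob A e else 0.
rewrite (_ : \sum_(e | _) _ = r.+1%:R^-1 * dot x (comb d *m x)).
  rewrite ler_wpM2l ?invr_ge0 //; apply: comb_le1 => c; rewrite /d.
  by case: ifP => [cA|_]; [apply: cond_prob_le | apply: cond_prob_ge0].
rewrite comb_dot mulr_sumr big_mkcond; apply: eq_bigr => e _; rewrite /d /w.
by case: ifP => _; rewrite ?mul0r ?mulr0 // mulrA [_^-1 * _]mulrC.
Qed.

(** [one_step] with [sigma = 4 / r.+1], scaled by [r.+1 * N A] so that the weights become tree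
    counts. *)
Lemma expose_edge (H : 'M[R]_m) (theta : R) j : symm H ->
  (forall x, nsq x <= 2 * dot x (H *m x)) -> theta ^+ 2 <= 1 / 16 ->
  \sum_(e | P e) N (e |: A) * \tr ((H + (theta / (2 ^ j.+1)%:R) *:
       (cond_mean (e |: A) - cond_mean A)) ^+ (2 ^ j.+1))
    <= r.+1%:R * N A * ((1 + 32 * theta ^+ 2 / r.+1%:R) * \tr (H ^+ (2 ^ j.+1))).
Proof.
move=> sH Hge th.
have NA0 : 0 < N A by rewrite lt_def NA ntree_ge0.
have pos : 0 < r.+1%:R * N A by rewrite mulr_gt0 // ltr0n.
have step : \sum_(e | P e) w e * \tr ((H + (theta / (2 ^ j.+1)%:R) *:
       (cond_mean (e |: A) - cond_mean A)) ^+ (2 ^ j.+1))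
    <= (1 + 8 * theta ^+ 2 * (4 / r.+1%:R)) * \tr (H ^+ (2 ^ j.+1)).
  apply: one_step => //.
  - by move=> e _; rewrite combB; apply: comb_symm.
  - by move=> e x /andP[eA Ne]; apply: nsq_incr_le4.
  - by rewrite divr_ge0.
move: step; rewrite -(ler_pM2l pos) mulr_sumr.
rewrite (eq_bigr (fun e => N (e |: A) * \tr ((H + (theta / (2 ^ j.+1)%:R) *:
       (cond_mean (e |: A) - cond_mean A)) ^+ (2 ^ j.+1)))); last first.
  by move=> e _; rewrite wE mulrA [_ * (_ / _)]mulrC mulfVK ?gt_eqF.
move/le_trans; apply; rewrite le_eqVlt; apply/orP; left; apply/eqP.
by congr (_ * (_ * _)); ring.
Qed.

End Step.

(** The product of the [one_step] factors over one tree; [i.+1] is the number of edges still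
    hidden. *)
Definition growth (theta : R) r := \prod_(i < r) (1 + 32 * theta ^+ 2 / i.+1%:R).

(** Induction on the number [r] of hidden edges. The lower bound on [H] carries a margin of
    [1 / (2 M)] per hidden edge, the most that one exposure can consume, so [H >= 1/2] holds
    throughout. *)
Lemma tree_mgf r A (H : 'M[R]_m) (theta : R) j :
  (#|A| + r)%N = k -> N A != 0 -> symm H -> theta ^+ 2 <= 1 / 16 ->
  (forall x, (1 + r%:R / (2 ^ j.+1)%:R) / 2 * nsq x <= dot x (H *m x)) ->
  \sum_(T | tree T && (A \subset T)) \tr ((H + (theta / (2 ^ j.+1)%:R) *:
       (cond_mean T - cond_mean A)) ^+ (2 ^ j.+1))
    <= N A * (growth theta r * \tr (H ^+ (2 ^ j.+1))).
Proof.
elim: r A H => [|r IH] A H cardA NA sH th Hge.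
  rewrite /growth big_ord0 mul1r ntreeE mulr_suml; apply: ler_sum => T /andP[tT AT].
  have -> : A = T.
    by apply/eqP; rewrite eqEcard AT (card_treeE tT) -cardA addn0 leqnn.
  by rewrite subrr scaler0 addr0 mul1r.
set M := (2 ^ j.+1)%N in Hge *.
have M0 : (0 : R) < M%:R by rewrite ltr0n expn_gt0.
have kA : (k - #|A|)%N = r.+1 by rewrite -cardA addKn.
have r0 : (0 : R) < r.+1%:R by rewrite ltr0n.
(* Multiplying by [r.+1] lets the sum over trees be split according to the next exposed edge. *)
rewrite -(ler_pM2l r0) -{1}kA mulr_sumr -sum_add_edge.
pose Hs e := H + (theta / M%:R) *: (cond_mean (e |: A) - cond_mean A).
have sHs e : symm (Hs e).
  by rewrite /symm /Hs linearD linearZ /= sH combB comb_symm.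
have growth0 : 0 <= growth theta r.
  apply: prodr_ge0 => i _; rewrite addr_ge0 // divr_ge0 // mulr_ge0 //.
  exact: sqr_ge0.
apply: (@le_trans _ _ (\sum_(e | (e \notin A) && (N (e |: A) != 0))
     N (e |: A) * (growth theta r * \tr (Hs e ^+ M)))).
  rewrite (bigID (fun e => N (e |: A) != 0)) /= [X in _ + X]big1 ?addr0; last first.
    move=> e /andP[_ /negPn/eqP z]; apply: big1 => T /andP[tT].
    by rewrite (ntree_eq0 z tT).
  apply: ler_sum => e /andP[eA Ne].
  rewrite (eq_bigr (fun T => \tr ((Hs e + (theta / M%:R) *:
       (cond_mean T - cond_mean (e |: A))) ^+ M))); last first.
    move=> T _; congr (\tr (_ ^+ _)).
    rewrite /Hs -addrA -scalerDr; congr (_ + _ *: _).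
    by rewrite [RHS]addrC addrA subrK.
  apply: IH => //; first by rewrite cardsU1 eA add1n addSnnS.
  move=> x; have := Hge x.
  rewrite /Hs mulmxDl dotDr -scalemxAl dotZr.
  set Dx := (cond_mean _ - _) *m x => ge.
  have n4 : nsq Dx <= 4 * nsq x by apply: nsq_incr_le4.
  have d1 : dot x Dx <= 2 * nsq x /\ - (2 * nsq x) <= dot x Dx.
    have h1 := nsq_ge0 (2 *: x - Dx); have h2 := nsq_ge0 (2 *: x + Dx).
    by move: h1 h2; rewrite nsqB nsqD nsqZ dotZl expr2; split; lra.
  have : - (1 / 2 * nsq x) <= theta * dot x Dx.
    by case: d1; apply: small_mul_ge.
  rewrite -(ler_pM2l (_ : 0 < M%:R^-1)) ?invr_gt0 // => th3.
  move: ge; rewrite -natr1 mulrDl; move: th3; rewrite [theta / _]mulrC; lra.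
have Hge2 x : nsq x <= 2 * dot x (H *m x).
  have := Hge x; have : 0 <= r.+1%:R / M%:R * nsq x.
    by rewrite mulr_ge0 ?nsq_ge0 // divr_ge0.
  by rewrite mulrDl mul1r; lra.
have step := ler_wpM2l growth0 (expose_edge NA cardA j sH Hge2 th).
move: step; rewrite mulr_sumr -/M => step.
rewrite (eq_bigr (fun e => growth theta r * (N (e |: A) * \tr (Hs e ^+ M)))).
  apply: le_trans step _; rewrite /growth big_ord_recr /=.
  by rewrite le_eqVlt; apply/orP; left; apply/eqP; ring.
by move=> e _; rewrite mulrCA.
Qed.

End Martingale.

(** * Splitting a sequence into its first entry and the rest *)

Section FfunCons.
Variables (S : finType) (n : nat).

Definition ffun_cons (x : S) (g : {ffun 'I_n -> S}) : {ffun 'I_n.+1 -> S} :=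
  [ffun i => if unlift ord0 i is Some j then g j else x].

Lemma ffun_cons0 x g : ffun_cons x g ord0 = x.
Proof. by rewrite ffunE unlift_none. Qed.

Lemma ffun_consS x g i : ffun_cons x g (lift ord0 i) = g i.
Proof. by rewrite ffunE liftK. Qed.

Lemma sum_ffun_cons (R : nmodType) (P : pred S) (F : {ffun 'I_n.+1 -> S} -> R) :
  \sum_(f : {ffun 'I_n.+1 -> S} | [forall i, P (f i)]) F f =
  \sum_(x | P x) \sum_(g : {ffun 'I_n -> S} | [forall i, P (g i)])
    F (ffun_cons x g).
Proof.
rewrite pair_big /= (reindex (fun p : S * {ffun 'I_n -> S} => ffun_cons p.1 p.2)) /=.
  apply: eq_bigl => -[x g] /=; apply/forallP/andP => [H|[Px /forallP Pg] i].
    split; first by have := H ord0; rewrite ffun_cons0.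
    by apply/forallP => i; have := H (lift ord0 i); rewrite ffun_consS.
  by case: (unliftP ord0 i) => [j ->|->]; rewrite ?ffun_consS ?ffun_cons0.
exists (fun f => (f ord0, [ffun j => f (lift ord0 j)])) => [[x g] _|f _] /=.
  by congr pair; [rewrite ffun_cons0 | apply/ffunP => i; rewrite ffunE ffun_consS].
apply/ffunP => i; case: (unliftP ord0 i) => [j ->|->].
  by rewrite ffun_consS ffunE.
by rewrite ffun_cons0.
Qed.

End FfunCons.

(** * Trace moment and tail bound over independent rounds *)

Section Rounds.
Variables (R : rcfType) (V X : finType) (s t : X -> V).
Hypothesis has_tree : exists T, is_tree s t T.
Variables (m : nat) (a : X -> 'cV[R]_m).
Hypothesis parseval : forall x, \sum_c dot (a c) x ^+ 2 = nsq x.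
Hypothesis a_grad : forall x, exists phi, forall c, grad s t phi c = dot (a c) x.

Local Notation N := (ntree s t R).
Local Notation tree := (is_tree s t).
Local Notation Y := (edge_mx s t a).
Local Notation Z := (cond_mean s t a).

Let k := (#|V| - 1)%N.

Definition dev_mx T := Z T - Z set0.

Lemma dev_mx_symm T : symm (dev_mx T).
Proof. by rewrite /dev_mx combB; apply: comb_symm. Qed.

(** By cardinality the only tree containing [T] is [T], so the conditional probabilities are the
    indicator of [T]. *)
Lemma cond_mean_tree T x : tree T ->
  dot x (Z T *m x) = \sum_(c in T) dot x (Y c *m x).
Proof.
move=> tT; rewrite comb_dot [RHS]big_mkcond; apply: eq_bigr => c _.
have NT : N T != 0.
  by rewrite pnatr_eq0 cards_eq0; apply/set0Pn; exists T; rewrite inE tT subxx.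
case: ifPn => cT; first by rewrite cond_prob_in // mul1r.
suff -> : cond_prob R s t T c = 0 by rewrite mul0r.
rewrite /cond_prob (_ : N (c |: T) = 0) ?mul0r //.
apply/eqP; rewrite pnatr_eq0 cards_eq0; apply/eqP/setP => U; rewrite !inE.
apply/negP => /andP[tU /subset_leq_card]; rewrite cardsU1 cT.
by rewrite (card_treeE R tU) (card_treeE R tT) add1n ltnn.
Qed.

Lemma dev_mx_dot T x : tree T ->
  dot x (dev_mx T *m x) = \sum_(c in T) dot x (Y c *m x) - nsq x.
Proof.
move=> tT; rewrite /dev_mx mulmxBl dotBr cond_mean_tree // comb1_dot //.
Qed.

(** A crude bound suffices: it only sets the margin of [H], and the exponent [M] may be taken as
    large as needed. *)
Lemma dev_mx_bound T x : tree T ->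
  dot x (dev_mx T *m x) <= k.+1%:R * nsq x /\ - (k.+1%:R * nsq x) <= dot x (dev_mx T *m x).
Proof.
move=> tT; rewrite dev_mx_dot //.
have h1 : \sum_(c in T) dot x (Y c *m x) <= k%:R * nsq x.
  have -> : k%:R * nsq x = \sum_(c in T) nsq x.
    by rewrite sumr_const (card_treeE R tT) mulr_natl.
  apply: ler_sum => c _.
  exact: edge_mx_le1.
have h2 : 0 <= \sum_(c in T) dot x (Y c *m x).
  apply: sumr_ge0 => c _; rewrite -comb_edge; apply: comb_psd => c'.
  by rewrite ler0n.
have h3 : 0 <= k%:R * nsq x by rewrite mulr_ge0 ?nsq_ge0.
have := nsq_ge0 x; rewrite -natr1 mulrDl mul1r; split; lra.
Qed.

(** Peel off the first round: induction handles the later rounds with [H] shifted by its deviation,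
    then [tree_mgf] averages over the first tree. *)
Lemma rounds_mgf rho (H : 'M[R]_m) (theta : R) j :
  symm H -> theta ^+ 2 <= 1 / 16 ->
  (forall x, (1 + (rho * k.+1)%:R / (2 ^ j.+1)%:R) / 2 * nsq x <= dot x (H *m x)) ->
  \sum_(f : {ffun 'I_rho -> {set X}} | [forall i, tree (f i)])
     \tr ((H + (theta / (2 ^ j.+1)%:R) *: \sum_i dev_mx (f i)) ^+ (2 ^ j.+1))
    <= (N set0 * growth theta k) ^+ rho * \tr (H ^+ (2 ^ j.+1)).
Proof.
elim: rho H => [|rho IH] H sH th Hge.
  rewrite mul1r (big_pred1 [ffun=> set0]).
    by rewrite big_ord0 scaler0 addr0.
  move=> f; rewrite /= [RHS](_ : _ = true); first by apply/forallP => -[].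
  by apply/eqP/ffunP => -[].
set M := (2 ^ j.+1)%N in IH Hge *.
have M0 : (0 : R) < M%:R by rewrite ltr0n expn_gt0.
have growth0 : 0 <= growth theta k.
  apply: prodr_ge0 => i _; rewrite addr_ge0 // divr_ge0 // mulr_ge0 //.
  exact: sqr_ge0.
rewrite sum_ffun_cons /=.
pose HT T := H + (theta / M%:R) *: dev_mx T.
apply: (@le_trans _ _ (\sum_(T | tree T) (N set0 * growth theta k) ^+ rho
    * \tr (HT T ^+ M))).
  apply: ler_sum => T tT.
  rewrite (eq_bigr (fun g : {ffun 'I_rho -> {set X}} =>
      \tr ((HT T + (theta / M%:R) *: \sum_i dev_mx (g i)) ^+ M))); last first.
    move=> g _; rewrite big_ord_recl ffun_cons0 scalerDr addrA.
    by under eq_bigr do rewrite ffun_consS.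
  apply: IH => //.
    by rewrite /symm /HT linearD linearZ /= sH dev_mx_symm.
  move=> x; have := Hge x; rewrite /HT mulmxDl dotDr -scalemxAl dotZr.
  have [d1 d2] := dev_mx_bound x tT.
  have : - (1 / 2 * (k.+1%:R * nsq x)) <= theta * dot x (dev_mx T *m x).
    have : 0 <= k.+1%:R * nsq x by rewrite mulr_ge0 ?nsq_ge0.
    by move=> p; apply: small_mul_ge => //; lra.
  rewrite -(ler_pM2l (_ : 0 < M%:R^-1)) ?invr_gt0 // => th3.
  rewrite mulSn natrD mulrDl; move: th3; rewrite [theta / _]mulrC; lra.
rewrite -mulr_sumr exprSr -mulrA; apply: ler_wpM2l.
  by rewrite exprn_ge0 // mulr_ge0 // ntree_ge0.
have := @tree_mgf R V X s t has_tree m a parseval a_grad k set0 H theta j.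
rewrite cards0 add0n -mulrA => /(_ erefl); rewrite gt_eqF ?ntree0_gt0 //.
move=> /(_ isT sH th) step.
apply: le_trans (step _); last first.
  move=> x; apply: le_trans (Hge x).
  rewrite ler_wpM2r ?nsq_ge0 // ler_pM2r ?invr_gt0 // lerD2l.
  by rewrite ler_pM2r ?invr_gt0 // ler_nat (leq_trans (leqnSn k)) ?leq_pmull.
rewrite le_eqVlt; apply/orP; left; apply/eqP; apply: eq_bigl => T.
by rewrite sub0set andbT.
Qed.

Lemma tr_exp_ge0 (A : 'M[R]_m) j : symm A -> 0 <= \tr (A ^+ (2 ^ j.+1)).
Proof.
move=> sA; rewrite expnSr exprM expr2 -{2}sA -trmx_exp.
rewrite trE; apply: sumr_ge0 => i _; apply: sumr_ge0 => l _.
by rewrite mxE -expr2 sqr_ge0.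
Qed.

Lemma card_rounds rho : #|[set f : {ffun 'I_rho -> {set X}} | [forall i, tree (f i)]]|%:R
  = N set0 ^+ rho.
Proof.
rewrite cardsE -sumr_const; elim: rho => [|rho IH].
  rewrite expr0 (big_pred1 [ffun=> set0]) // => f.
  rewrite [RHS](_ : _ = true); first by apply/forallP => -[].
  by apply/eqP/ffunP => -[].
rewrite sum_ffun_cons IH exprS sumr_const -mulr_natl ntreeE sumr_const.
congr (_%:R * _); by apply: eq_card => T; rewrite -!topredE /= sub0set andbT.
Qed.

(** Markov's inequality by counting, started at [H = 1]. By [exp_le_tr] each bad outcome contributes
    at least the stated power; the others contribute nonnegatively as the exponent is even. The sign
    [sg] selects the tail and is absorbed into [theta]. *)
Lemma rounds_tail rho (B : pred {ffun 'I_rho -> {set X}}) (theta sg d : R) j :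
  0 <= theta -> theta ^+ 2 <= 1 / 16 -> sg ^+ 2 = 1 -> 0 <= d ->
  (rho * k.+1 <= 2 ^ j.+1)%N ->
  (forall f, B f -> [forall i, tree (f i)] -> exists2 x : 'cV_m, x != 0 &
     d * nsq x <= sg * \sum_i dot x (dev_mx (f i) *m x)) ->
  #|[set f : {ffun 'I_rho -> {set X}} | [forall i, tree (f i)] && B f]|%:R
     * (1 + theta * d / (2 ^ j.+1)%:R) ^+ (2 ^ j.+1)
  <= N set0 ^+ rho * (growth theta k ^+ rho * m%:R).
Proof.
move=> th0 th sg2 d0 leM HB; set M := (2 ^ j.+1)%N in leM *.
have M0 : (0 : R) < M%:R by rewrite ltr0n expn_gt0.
have sth : (sg * theta) ^+ 2 = theta ^+ 2 by rewrite exprMn sg2 mul1r.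
have th' : (sg * theta) ^+ 2 <= 1 / 16 by rewrite sth.
have step := @rounds_mgf rho 1 (sg * theta) j (trmx1 _ _) th'.
rewrite mulrA -exprMn.
have -> : growth theta k = growth (sg * theta) k.
  by apply: eq_bigr => i _; rewrite sth.
have -> : m%:R = \tr ((1 : 'M[R]_m) ^+ M) by rewrite expr1n mxtrace1.
apply: le_trans (step _); last first.
  move=> x; rewrite mul1mx -/(nsq x) -[leRHS]mul1r ler_wpM2r ?nsq_ge0 //.
  have : (rho * k.+1)%:R / M%:R <= 1 :> R by rewrite ler_pdivrMr // mul1r ler_nat.
  lra.
rewrite cardsE mulr_natl -sumr_const big_mkcondr /=.
apply: ler_sum => f vf.
set A := (_ + _ *: _ : 'M_m).
have sA : symm A.
  rewrite /symm /A linearD linearZ /= trmx1 raddf_sum; congr (_ + _ *: _).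
  by apply: eq_bigr => i _; apply: dev_mx_symm.
case: ifP => Bf; last exact: tr_exp_ge0.
have [x x0 Hx] := HB f Bf vf.
apply: (@exp_le_tr _ _ _ x) => //.
  by rewrite addr_ge0 // divr_ge0 // mulr_ge0.
rewrite /A mulmxDl mul1mx dotDr mulrDl mul1r lerD2l -scalemxAl dotZr.
rewrite mulmx_suml dot_sumr.
have := ler_wpM2l th0 Hx; rewrite -(ler_pM2l (_ : 0 < M%:R^-1)) ?invr_gt0 //.
set S := \sum_i _ => H.
rewrite (_ : theta * d / M%:R * nsq x = M%:R^-1 * (theta * (d * nsq x))); last by ring.
by rewrite (_ : sg * theta / M%:R * S = M%:R^-1 * (theta * (sg * S))); last by ring.
Qed.

End Rounds.

(** * Orthonormal coordinates on the space of gradients *)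

Section Basis.
Variable R : rcfType.

(** Gram-Schmidt by Cholesky: if [K * K^T] is the Gram matrix of a row basis [D], then [K^-1 * D]
    has orthonormal rows. *)
Lemma orthonormal_rows p q (B : 'M[R]_(p, q)) :
  exists (m : nat) (Q : 'M[R]_(m, q)), [/\ (m <= p)%N, Q *m Q^T = 1%:M & (Q :=: B)%MS].
Proof.
pose D := row_base B; pose H := D *m D^T.
have sH : symm H by rewrite /symm /H trmx_mul trmxK.
have pH (x : 'cV_(\rank B)) : x != 0 -> 0 < dot x (H *m x).
  move=> x0; rewrite /H -mulmxA dot_mulmx -/(nsq _) lt_def nsq_ge0 andbT nsq_eq0.
  apply: contraNneq x0 => /(congr1 trmx); rewrite trmx_mul trmxK trmx0 => xD.
  by rewrite -trmx_eq0; apply/eqP; apply: (row_free_inj (row_base_free B));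
    rewrite mul0mx.
have [K defK uK] := cholesky_unit sH pH.
exists (\rank B), (invmx K *m D); split; first exact: rank_leq_row.
  rewrite trmx_mul mulmxA -(mulmxA _ D) -/H -defK !mulmxA mulVmx // mul1mx.
  by rewrite -trmx_mul mulVmx // trmx1.
apply: eqmx_trans (eq_row_base B); apply: eqmxMfull.
by rewrite row_full_unit unitmx_inv.
Qed.

Variables (V X : finType) (s t : X -> V).

(** The rows of the incidence matrix [B] span the gradients. With [Q] an orthonormal basis of that
    span, [a c] is the column of [Q] at [c]. *)
Lemma grad_basis : exists (m : nat) (a : X -> 'cV[R]_m),
  [/\ (m <= #|V|)%N,
      forall x, \sum_c dot (a c) x ^+ 2 = nsq x,
      forall x, exists phi, forall c, grad s t phi c = dot (a c) x &
      forall phi, exists x, forall c, grad s t phi c = dot (a c) x].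
Proof.
pose B : 'M[R]_(#|V|, #|X|) := \matrix_(i, c)
  ((enum_val i == s (enum_val c))%:R - (enum_val i == t (enum_val c))%:R).
have BE (phi : 'rV_#|V|) c : (phi *m B) 0 (enum_rank c) =
    grad s t (fun v => phi 0 (enum_rank v)) c.
  rewrite mxE /grad; under eq_bigr do rewrite mxE enum_rankK mulrBr.
  have D v : \sum_i phi 0 i * (enum_val i == v)%:R = phi 0 (enum_rank v).
    rewrite (bigD1 (enum_rank v)) //= enum_rankK eqxx mulr1 big1 ?addr0 // => i.
    move=> iv; rewrite (_ : _ == v = false) ?mulr0 //.
    by apply: contraNF iv => /eqP <-; rewrite enum_valK.
  by rewrite sumrB !D.
have [m [Q [le_m QQ QB]]] := orthonormal_rows B.
pose a c := col (enum_rank c) Q.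
have aE c x : dot (a c) x = (x^T *m Q) 0 (enum_rank c).
  by rewrite dotE mxE; apply: eq_bigr => i _; rewrite !mxE mulrC.
exists m, a; split=> //.
- move=> x; under eq_bigr do rewrite aE.
  have -> : nsq x = (x^T *m Q *m (x^T *m Q)^T) 0 0.
    by rewrite trmx_mul trmxK mulmxA -(mulmxA _ Q) QQ mulmx1.
  rewrite mxE (reindex enum_rank) /=; last first.
    by exists enum_val => i _; rewrite ?enum_rankK ?enum_valK.
  by apply: eq_bigr => c _; rewrite [(_ ^T) _ _]mxE expr2.
- move=> x; have /submxP[phi E] : (x^T *m Q <= B)%MS.
    by rewrite -QB submxMl.
  by exists (fun v => phi 0 (enum_rank v)) => c; rewrite aE E BE.
move=> phi; pose p : 'rV[R]_#|V| := \row_i phi (enum_val i).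
have /submxP[y E] : (p *m B <= Q)%MS by rewrite QB submxMl.
exists y^T => c; rewrite aE trmxK -E BE /grad !mxE !enum_rankK //.
Qed.

End Basis.

From mathcomp Require Import all_classical all_reals all_analysis.
From mathcomp Require Import Rstruct.

(** * Choice of the parameters *)

Section Numerics.
Variable R : realType.

Lemma ln_ge_half n : (2 <= n)%N -> 1 / 2 <= ln (n%:R : R).
Proof.
move=> n2; have n0 : (0 : R) < n%:R by rewrite ltr0n; apply: leq_trans n2.
rewrite -ler_expR lnK ?posrE //; apply: (@le_trans _ _ 2); last by rewrite ler_nat.
have := expR_ge1Dx (- (1 / 2 : R)); rewrite expRN => H.
have e0 := expR_gt0 (1 / 2 : R).
have : expR (1 / 2 : R) * (1 + - (1 / 2)) <= 1.
  by apply: le_trans (ler_wpM2l (ltW e0) H) _; rewrite divff ?gt_eqF.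
by lra.
Qed.

Lemma harmonic_le n : (0 < n)%N -> \sum_(i < n) i.+1%:R^-1 <= 1 + ln (n%:R : R).
Proof.
elim: n => // -[|n] IH _; first by rewrite big_ord1 ln1 addr0 invr1.
rewrite big_ord_recr /=.
apply: le_trans (lerD (IH isT) (lexx _)) _.
rewrite -addrA lerD2l.
have n1 : (0 : R) < n.+1%:R by rewrite ltr0n.
have n2 : (0 : R) < n.+2%:R by rewrite ltr0n.
have : ln (n.+1%:R / n.+2%:R : R) <= - n.+2%:R^-1.
  have -> : n.+1%:R / n.+2%:R = 1 + - n.+2%:R^-1 :> R.
    rewrite (_ : n.+1%:R = n.+2%:R - 1 :> R); last by rewrite -[n.+2%:R]natr1 addrK.
    by rewrite mulrBl divff ?gt_eqF // mul1r.
  apply: le_ln1Dx; rewrite ltrN2 invf_lt1 // ltr1n //.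
rewrite ln_div ?posrE //.
by move: (ln n.+1%:R) (ln n.+2%:R) (n.+2%:R^-1) => x y z; lra.
Qed.

Lemma harmonic_le_ln n : (2 <= n)%N ->
  \sum_(i < n - 1) i.+1%:R^-1 <= 8 * ln (n%:R : R).
Proof.
move=> n2; have := harmonic_le (ltnW n2); have := ln_ge_half n2.
have -> : \sum_(i < n) i.+1%:R^-1 = \sum_(i < n - 1) i.+1%:R^-1 + n%:R^-1 :> R.
  by case: n n2 => // n _; rewrite subn1 /= big_ord_recr.
have : (0 : R) <= n%:R^-1 by [].
by move: (n%:R^-1) (ln _) (\sum_(i < n - 1) _) => x y z; lra.
Qed.

Lemma growth_le (theta : R) k : growth theta k <=
  expR (32 * theta ^+ 2 * \sum_(i < k) i.+1%:R^-1).
Proof.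
rewrite mulr_sumr expR_sum; apply: ler_prod => i _.
have h : 0 <= 32 * theta ^+ 2 / i.+1%:R by rewrite divr_ge0 // mulr_ge0 // sqr_ge0.
by rewrite expR_ge1Dx andbT addr_ge0.
Qed.

(** On [0 <= b <= 1], [(1 + b) (1 - b / 2) >= 1] and [exp (- b / 2) >= 1 - b / 2] give
    [exp (b / 2) <= 1 + b]; raise to the power [M]. *)
Lemma exp_half_le (y : R) M : (0 < M)%N -> 0 <= y <= M%:R ->
  expR (y / 2) <= (1 + y / M%:R) ^+ M.
Proof.
move=> M0 /andP[y0 yM]; have M0' : (0 : R) < M%:R by rewrite ltr0n.
set b := y / M%:R.
have b0 : 0 <= b by rewrite divr_ge0.
have b1 : b <= 1 by rewrite ler_pdivrMr // mul1r.
have -> : y / 2 = b / 2 * M%:R by rewrite /b; field; rewrite gt_eqF.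
rewrite expRM_natr; apply: lerXn2r; rewrite ?nnegrE ?expR_ge0 //; first lra.
have := expR_ge1Dx (- (b / 2)); rewrite expRN => H.
have e0 := expR_gt0 (b / 2).
have h1 : expR (b / 2) * (1 + - (b / 2)) <= 1.
  by apply: le_trans (ler_wpM2l (ltW e0) H) _; rewrite divff ?gt_eqF.
have h2 : 1 <= (1 + b) * (1 + - (b / 2)).
  have : 0 <= b * (1 - b) by rewrite mulr_ge0 //; lra.
  lra.
rewrite -(ler_pM2r (_ : 0 < 1 + - (b / 2))); last lra.
exact: le_trans h1 h2.
Qed.

(** The term [L] pays for the dimension and [7 * L] gives failure probability [n^-7] per tail. For
    moderate [eps], with [y] as in the proof, the growth term is [y] and the gain [2 * y], so
    [y >= 8 * L] suffices; for larger [eps], [theta] is capped at 1/4. *)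
Lemma choose_theta (L eps rho : R) : 0 < L -> 0 < eps -> 1 <= rho ->
  8 * (64 * 64) * L ^+ 2 <= rho * eps ^+ 2 ->
  exists theta, [/\ 0 <= theta, theta ^+ 2 <= 1 / 16 &
    32 * theta ^+ 2 * (8 * L) * rho + L <= - (7 * L) + theta * (rho * eps) / 2].
Proof.
move=> L0 eps0 rho1 H.
have [le|gt] := lerP eps (16 * 16 * L).
  exists (eps / (32 * 32 * L)); split.
  - by rewrite divr_ge0 // ltW // mulr_gt0.
  - have : eps / (32 * 32 * L) <= 1 / 4 by rewrite ler_pdivrMr ?mulr_gt0 //; lra.
    have : 0 <= eps / (32 * 32 * L) by rewrite divr_ge0 // ltW // mulr_gt0.
    by rewrite expr2; nra.
  - set y := rho * eps ^+ 2 / (64 * 64 * L).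
    have y_ge : 8 * L <= y.
      rewrite ler_pdivlMr ?mulr_gt0 //; apply: le_trans H.
      by rewrite expr2; lra.
    have -> : 32 * (eps / (32 * 32 * L)) ^+ 2 * (8 * L) * rho = y.
      by rewrite /y; field; rewrite gt_eqF.
    have -> : eps / (32 * 32 * L) * (rho * eps) / 2 = 2 * y.
      by rewrite /y; field; rewrite gt_eqF.
    by lra.
exists (1 / 4); split; [lra|by rewrite expr2; lra|].
have : rho * (16 * 16 * L) <= rho * eps by rewrite ler_wpM2l //; lra.
have : L <= rho * L by rewrite ler_peMl // ltW.
by rewrite expr2; lra.
Qed.

End Numerics.

(** * Effective conductances and cuts *)

Section Link.
Variables (V E : finType) (s t : E -> V) (u : E -> nat).
Hypotheses (loopless : forall e, s e != t e) (u_gt0 : forall e, (0 < u e)%N)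
  (conn : graph_connected s t).

Local Notation X := (Copy u).

Definition copy_src (c : X) := s (tag c).
Definition copy_tgt (c : X) := t (tag c).

Local Notation src := copy_src.
Local Notation tgt := copy_tgt.

Local Notation N := (ntree src tgt RR).
Local Notation ener := (@ener V X src tgt RR).

Lemma copy_exists e : exists c : X, tag c = e.
Proof. by exists (existT (fun e => 'I_(u e)) e (Ordinal (u_gt0 e))). Qed.

Lemma sum_copy (F : E -> RR) : \sum_(c : X) F (tag c) = \sum_e (u e)%:R * F e.
Proof.
rewrite -(@sig_big_dep _ _ _ _ _ predT (fun _ => predT) (fun e _ => F e)) /=.
by apply: eq_bigr => e _; rewrite sumr_const card_ord mulr_natl.
Qed.

Lemma exists_spanning_tree : exists T, is_tree src tgt T.
Proof.
apply: exists_tree => x y; move: (conn x y); apply: connect_sub => a b.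
move=> /existsP[e H]; apply: connect1; apply/existsP.
by have [c ce] := copy_exists e; exists c; rewrite inE /copy_src /copy_tgt ce.
Qed.

Lemma current_outE phi v : current_out s t u phi v =
  ener phi (fun x => (x == v)%:R).
Proof.
transitivity (\sum_e (u e)%:R *
    ((phi (s e) - phi (t e)) * ((s e == v)%:R - (t e == v)%:R))); last first.
  by rewrite -sum_copy.
apply: eq_bigr => f _.
have [sv|sv] := eqVneq (s f) v.
  have -> : (t f == v) = false by rewrite -sv eq_sym; apply/negbTE.
  by rewrite subr0 mulr1 sv.
case: eqVneq => [tv|_]; last by rewrite subr0 !mulr0.
by rewrite tv /=; ring.
Qed.

Lemma ener_delta phi psi : ener phi psi =
  \sum_v psi v * ener phi (fun x => (x == v)%:R).
Proof.
have D (w : V) : psi w = \sum_v psi v * (w == v)%:R.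
  rewrite (bigD1 w) //= eqxx mulr1 big1 ?addr0 // => i.
  by rewrite eq_sym => /negbTE->; rewrite mulr0.
under [RHS]eq_bigr do rewrite mulr_sumr.
rewrite exchange_big; apply: eq_bigr => c _ /=.
rewrite /grad [psi (src c)]D [psi (tgt c)]D -sumrB mulr_sumr.
by apply: eq_bigr => v _; ring.
Qed.

(** Every copy lies in some tree: otherwise [dirichlet], tested on the indicator of its source,
    would leave no tree at all. *)
Lemma ntree1_neq0 c : N (c |: finset.set0) != 0.
Proof.
have := @dirichlet _ _ src tgt RR finset.set0 c (fun x => (x == src c)%:R).
rewrite finset.in_set0 => /(_ isT) H; apply/eqP => z.
have : N finset.set0 <= 0.
  rewrite -[leLHS]mulr1; apply: (le_trans _ (le_trans (H _) _)).
  - rewrite /grad eqxx eq_sym [_ == _](negbTE (loopless (tag c))).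
    by rewrite subr0 expr1n.
  - by move=> f; rewrite finset.in_set0.
  - by rewrite z mul0r.
by rewrite leNgt ntree0_gt0 //; exact: exists_spanning_tree.
Qed.

Lemma eff_condE c : eff_cond s t u (tag c) = (cond_prob RR src tgt finset.set0 c)^-1.
Proof.
pose e := tag c; have Nc := ntree1_neq0 c.
pose P := tree_pot src tgt RR finset.set0 c.
pose phi v := (P v - P (t e)) / N (c |: finset.set0).
have gphi f : grad src tgt phi f = grad src tgt P f / N (c |: finset.set0).
  by rewrite /grad /phi; field.
have phis : phi (s e) = 1.
  have := grad_tree_pot src tgt RR finset.set0 c.
  by rewrite /grad -/P /phi => ->; rewrite divff.
have phit : phi (t e) = 0 by rewrite /phi subrr mul0r.
have enphi psi : ener phi psi = N finset.set0 / N (c |: finset.set0) * grad src tgt psi c.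
  rewrite mulrAC -ener_tree_pot ?finset.in_set0 //; last by move=> f; rewrite finset.in_set0.
  by rewrite mulr_suml; apply: eq_bigr => f _; rewrite gphi mulrAC.
have -> : (cond_prob RR src tgt finset.set0 c)^-1 = N finset.set0 / N (c |: finset.set0).
  by rewrite /cond_prob invf_div.
have : is_eff_cond s t u e (eff_cond s t u e).
  apply: epsilon_spec; exists (N finset.set0 / N (c |: finset.set0)), phi; do !split => //.
    move=> v vs vt; rewrite current_outE enphi /grad /copy_src /copy_tgt -/e.
    by rewrite ![_ == v]eq_sym (negbTE vs) (negbTE vt) subrr mulr0.
  rewrite current_outE enphi /grad /copy_src /copy_tgt -/e eqxx eq_sym.
  by rewrite (negbTE (loopless e)) subr0 mulr1.
(* [epsilon] may return any admissible value, so uniqueness is needed: pairing an arbitrary solution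
   [psi] with [phi] gives its current by harmonicity and the tree quotient by [enphi]. *)
move=> [psi [psis [psit [harm ->]]]].
have : ener psi phi = N finset.set0 / N (c |: finset.set0).
  by rewrite enerC enphi /grad /copy_src /copy_tgt -/e psis psit subr0 mulr1.
move=> <-; rewrite ener_delta (bigD1 (s e)) //= phis mul1r big1 ?addr0.
  by rewrite current_outE.
move=> v vs; have [->|vt] := eqVneq v (t e); first by rewrite phit mul0r.
by rewrite -current_outE harm ?mulr0.
Qed.

End Link.

Lemma card_valid_gt0 (V E : finType) (s t : E -> V) (u : E -> nat) rho :
  (forall e, (0 < u e)%N) -> graph_connected s t ->
  (0 : RR) < #|[set f : outcome u rho | valid s t f]|%:R.
Proof.
move=> u_gt0 conn.
have -> : #|[set f : outcome u rho | valid s t f]|%:R =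
    ntree (@copy_src V E s u) (@copy_tgt V E t u) RR finset.set0 ^+ rho.
  exact: card_rounds.
by rewrite exprn_gt0 ?ntree0_gt0 //; apply: exists_spanning_tree.
Qed.

(** * Cut weights, their tails and the number of output edges *)

Section Main.
Variables (V E : finType) (s t : E -> V) (u : E -> nat).
Hypotheses (loopless : forall e, s e != t e) (u_gt0 : forall e, (0 < u e)%N)
  (conn : graph_connected s t).
Variable rho : nat.
Hypothesis rho_gt0 : (0 < rho)%N.

Local Notation X := (Copy u).
Local Notation src := (@copy_src V E s u).
Local Notation tgt := (@copy_tgt V E t u).
Local Notation N := (ntree src tgt RR).

Implicit Types (f : outcome u rho) (S : {set V}).

Definition cut_u S : RR := \sum_(e | in_cut s t S e) (u e)%:R.
Definition cut_w f S : RR := \sum_(e | in_cut s t S e) out_weight s t f e.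

(** The sign [sg] is 1 for a cut that is too heavy and -1 for one that is too light. *)
Definition deviates (eps sg : RR) f :=
  [exists S : {set V}, eps * cut_u S < sg * (cut_w f S - cut_u S)].

Lemma not_cut_approx eps f : ~~ cut_approx s t eps f ->
  deviates eps 1 f || deviates eps (-1) f.
Proof.
rewrite negb_forall => /existsP[S]; rewrite -/(cut_u S) -/(cut_w f S) -ltNge => H.
have [le|lt] := lerP (cut_u S) (cut_w f S).
  apply/orP; left; apply/existsP; exists S; rewrite mul1r.
  by move: H; rewrite distrC ger0_norm // subr_ge0.
apply/orP; right; apply/existsP; exists S; rewrite mulN1r opprB.
by move: H; rewrite gtr0_norm // subr_gt0.
Qed.

Lemma grad_ind S (c : X) :
  grad src tgt (fun v => (v \in S)%:R : RR) c ^+ 2 = (in_cut s t S (tag c))%:R.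
Proof.
rewrite /grad /in_cut /copy_src /copy_tgt; do 2 case: (_ \in S) => /=;
  by rewrite ?subrr ?subr0 ?sub0r ?sqrrN ?expr1n ?expr0n.
Qed.

Lemma cut_wE f S : cut_w f S * rho%:R =
  \sum_k \sum_(c in f k) eff_cond s t u (tag c) * (in_cut s t S (tag c))%:R.
Proof.
have r0 : (rho%:R : RR) != 0 by rewrite pnatr_eq0 -lt0n.
rewrite /cut_w mulr_suml /out_weight.
under eq_bigr do rewrite mulr_suml.
rewrite exchange_big /=; apply: eq_bigr => k _.
rewrite (partition_big (fun c : X => tag c) predT) //= [LHS]big_mkcond.
apply: eq_bigr => e _; rewrite -mulrA divfK //.
rewrite (eq_bigr (fun _ => eff_cond s t u e * (in_cut s t S e)%:R)); last first.
  by move=> c /andP[_ /eqP->].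
rewrite sumr_const.
have -> : #|[set c in f k | tag c == e]| = #|[pred c | (c \in f k) && (tag c == e)]|.
  by apply: eq_card => c; rewrite !inE.
by case: in_cut; rewrite ?mulr1 ?mulr0 ?mul0rn // mulr_natl.
Qed.

Section Coordinates.
Variables (m : nat) (a : X -> 'cV[RR]_m).
Hypotheses (parseval : forall x, \sum_c dot (a c) x ^+ 2 = nsq x)
  (a_grad : forall x, exists phi, forall c, grad src tgt phi c = dot (a c) x)
  (a_onto : forall phi, exists x, forall c, grad src tgt phi c = dot (a c) x).

Let has_tree := exists_spanning_tree u_gt0 conn.

(** Take [x] encoding the indicator of [S]: [nsq x] is the graph cut, and the summed deviation form
    is [rho] times the cut error. *)
Lemma deviates_dev eps sg f : 0 <= eps -> deviates eps sg f -> valid s t f ->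
  exists2 x : 'cV_m, x != 0 & rho%:R * eps * nsq x <=
    sg * \sum_i dot x (dev_mx src tgt a (f i) *m x).
Proof.
move=> eps0 /existsP[S H] vf.
have [x xE] := a_onto (fun v => (v \in S)%:R).
have nsqE : nsq x = cut_u S.
  rewrite -parseval; under eq_bigr do rewrite -xE grad_ind.
  rewrite (sum_copy u (fun e => (in_cut s t S e)%:R)) /cut_u [RHS]big_mkcond.
  by apply: eq_bigr => e _; case: in_cut; rewrite ?mulr1 ?mulr0.
have devE : \sum_i dot x (dev_mx src tgt a (f i) *m x) =
    rho%:R * (cut_w f S - cut_u S).
  under eq_bigr => i _.
    rewrite dev_mx_dot //; last by move/forallP: vf; apply.
    under eq_bigr do
      rewrite edge_mx_dot -xE grad_ind -(eff_condE loopless u_gt0 conn).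
    over.
  rewrite sumrB -cut_wE sumr_const card_ord nsqE -[_ *+ rho]mulr_natr.
  by ring.
exists x.
  apply/eqP => x0; move: nsqE; rewrite x0 /nsq dot0r => /esym z.
  have cut0 e : in_cut s t S e = false.
    apply/negbTE/negP => ce; move/eqP: z; rewrite psumr_eq0 // => /allP/(_ e).
    rewrite mem_index_enum ce /= pnatr_eq0 => /(_ isT)/eqP ue.
    by have := u_gt0 e; rewrite ue.
  move: H; rewrite z /cut_w big_pred0 ?subrr ?mulr0 ?ltxx //.
rewrite devE nsqE -mulrA [leRHS]mulrCA ler_wpM2l //.
by rewrite ltW.
Qed.

End Coordinates.

Lemma card_deviates (eps sg : RR) : (1 < #|V|)%N -> 0 < eps -> sg ^+ 2 = 1 ->
  8 * (64 * 64) * ln (#|V|%:R : RR) ^+ 2 <= rho%:R * eps ^+ 2 ->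
  #|[set f : outcome u rho | valid s t f && deviates eps sg f]|%:R <=
  #|[set f : outcome u rho | valid s t f]|%:R * expR (- (7 * ln (#|V|%:R : RR))).
Proof.
move=> n2 eps0 sg2 rho_ge; set n := #|V| in n2 rho_ge *; set L := ln _ in rho_ge *.
have n0 : (0 : RR) < n%:R by rewrite ltr0n; apply: leq_trans n2.
have L2 : 1 / 2 <= L by apply: ln_ge_half.
have rho1 : (1 : RR) <= rho%:R by rewrite ler1n.
have L0 : 0 < L by lra.
have [theta [th0 th16 thH]] := choose_theta L0 eps0 rho1 rho_ge.
have [m [a [le_m parseval a_grad a_onto]]] := grad_basis RR src tgt.
have has_tree := exists_spanning_tree u_gt0 conn.
pose d := rho%:R * eps.
have d0 : 0 <= d by rewrite mulr_ge0 // ltW.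
(* The exponent [M = 2 ^ B.+1] must cover the margin required by [rounds_tail] and exceed
   [theta * d] for [exp_half_le]. *)
pose B := maxn (rho * (n - 1).+1) `|Num.ceil (theta * d)|%N.
have BM : (B <= 2 ^ B.+1)%N.
  by apply: leq_trans (ltnW (ltn_expl B (isT : 1 < 2)%N)) _; rewrite leq_exp2l.
set M := (2 ^ B.+1)%N in BM.
have M0 : (0 < M)%N by rewrite expn_gt0.
have thd : theta * d <= M%:R.
  apply: le_trans (ceil_ge _) _; rewrite -[M%:R]/(M%:Z%:~R) ler_int.
  apply: le_trans (ler_norm _) _; rewrite -abszE lez_nat (leq_trans _ BM) //.
  exact: leq_maxr.
have := @rounds_tail RR V X src tgt has_tree m a parseval a_grad rho
   (deviates eps sg) theta sg d B th0 th16 sg2 d0 _ _.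
move=> /(_ (leq_trans (leq_maxl _ _) BM)) tail.
have {}tail := tail (fun f Bf vf => deviates_dev parseval a_grad a_onto (ltW eps0) Bf vf).
rewrite -/M in tail.
have cardN : #|[set f : outcome u rho | valid s t f]|%:R = N finset.set0 ^+ rho.
  exact: (card_rounds RR src tgt rho).
rewrite cardN.
have N0 : 0 <= N finset.set0 ^+ rho by rewrite exprn_ge0 ?ntree_ge0.
have low := exp_half_le M0 (_ : 0 <= theta * d <= M%:R).
rewrite thd mulr_ge0 // in low; have {}low := low isT.
have up : growth theta (n - 1) ^+ rho * m%:R <=
    expR (32 * theta ^+ 2 * (8 * L) * rho%:R + L).
  rewrite exp.expRD lnK ?posrE //; apply: ler_pM => //.
  - apply: exprn_ge0; apply: prodr_ge0 => i _; rewrite addr_ge0 // divr_ge0 //.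
    by rewrite mulr_ge0 // sqr_ge0.
  - rewrite expRM_natr lerXn2r ?nnegrE ?expR_ge0 //.
      apply: prodr_ge0 => i _; rewrite addr_ge0 // divr_ge0 //.
      by rewrite mulr_ge0 // sqr_ge0.
    apply: le_trans (growth_le _ _) _; rewrite ler_expR ler_wpM2l //.
      by rewrite mulr_ge0 // sqr_ge0.
    exact: harmonic_le_ln.
  - by rewrite ler_nat.
have e0 := expR_gt0 (theta * d / 2).
rewrite -(ler_pM2r e0) -[leRHS]mulrA -exp.expRD.
apply: (@le_trans _ _ (N finset.set0 ^+ rho * (growth theta (n - 1) ^+ rho * m%:R))).
  by apply: le_trans tail; rewrite ler_wpM2l.
rewrite ler_wpM2l //; by apply: le_trans up _; rewrite ler_expR.
Qed.

Lemma prob_cut_approx_ge (eps : RR) : (1 < #|V|)%N -> 0 < eps ->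
  8 * (64 * 64) * ln (#|V|%:R : RR) ^+ 2 <= rho%:R * eps ^+ 2 ->
  1 - (#|V|%:R)^-1 <= prob_cut_approx s t u rho eps.
Proof.
move=> n2 eps0 rho_ge; rewrite /prob_cut_approx.
set good := #|_|; set all := #|_|.
have all0 : (0 : RR) < all%:R by apply: card_valid_gt0.
rewrite ler_pdivlMr //.
pose dv sg := #|[set f : outcome u rho | valid s t f && deviates eps sg f]|.
have cover : (all <= good + (dv 1%R + dv (-1)%R))%N.
  rewrite /all /good /dv; apply: leq_trans (leq_add (leqnn _) (leq_card_setU _ _)).
  apply: leq_trans (leq_card_setU _ _); apply: subset_leq_card.
  apply/fintype.subsetP => f; rewrite !inE => -> /=.
  by case: (boolP (cut_approx _ _ _ _)) => //= /not_cut_approx.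
have h1 := @card_deviates eps 1 n2 eps0 (expr1n _ _) rho_ge.
have h2 := @card_deviates eps (-1) n2 eps0 (sqrr_sign _ 1) rho_ge.
move: cover; rewrite -(ler_nat RR) !natrD => cover.
set L := ln _ in h1 h2.
have n0 : (0 : RR) < #|V|%:R by rewrite ltr0n; apply: leq_trans n2.
have L2 : 1 / 2 <= L by apply: ln_ge_half.
(* Union bound over the two tails: [2 <= n = exp L] turns [2 n^-7] into at most [n^-6]. *)
have small : 2 * expR (- (7 * L)) <= (#|V|%:R)^-1.
  rewrite -[#|V|%:R in leRHS]lnK ?posrE // -/L -exp.expRN.
  apply: (@le_trans _ _ (expR L * expR (- (7 * L)))).
    by rewrite ler_wpM2r ?expR_ge0 // lnK ?posrE // ler_nat.
  by rewrite -exp.expRD ler_expR; lra.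
have := ler_wpM2l (ltW all0) small; rewrite -/(dv _) -/all in h1 h2.
move: h1 h2; rewrite -/all; lra.
Qed.

Lemma card_out_edges f : valid s t f -> (#|out_edges f| <= rho * (#|V| - 1))%N.
Proof.
move=> /forallP vf.
have sub : out_edges f \subset (\bigcup_(k < rho) [set tag c | c in f k])%SET.
  apply/fintype.subsetP => e; rewrite inE => /existsP[k /existsP[c /andP[cf /eqP ce]]].
  by apply/finset.bigcupP; exists k => //; apply/imsetP; exists c.
apply: leq_trans (subset_leq_card sub) _.
rewrite -[rho in leqRHS]card_ord -sum_nat_const.
elim/big_rec2: _ => [|k A B _ IH]; first by rewrite cards0.
apply: leq_trans (leq_card_setU _ _) (leq_add _ _) => //.
apply: leq_trans (leq_imset_card _ _) _.
by rewrite (card_treeE RR (vf k : is_tree src tgt (f k))).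
Qed.

End Main.

Theorem theorem1p5 :
  exists C : RR, 0 < C /\ exists c : RR, 0 < c /\
  forall (V E : finType) (s t : E -> V) (u : E -> nat) (eps : RR),
    simple_graph s t ->
    (forall e, (0 < u e)%N) ->
    graph_connected s t ->
    1 / (#|V|%:R : RR) <= eps ->
    let n := #|V| in
    let rho := rounds C eps n in
    (forall f : outcome u rho, valid s t f ->
        (#|out_edges f| <= rho * (n - 1))%N) /\
    1 - (n%:R : RR) `^ (- c) <= prob_cut_approx s t u rho eps.
Proof.
(* The constant [C] is the one required by [choose_theta]; the failure probability [1 / n] gives
   exponent 1. *)
exists (8 * (64 * 64)); split; first by rewrite !mulr_gt0.
exists 1; split => // V E s t u eps [loopless _] u_gt0 conn eps_ge n rho.
split; first by move=> f; apply: card_out_edges.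
have [n2|n1] := ltnP 1 n.
  have n0 : (0 : RR) < n%:R by rewrite ltr0n; apply: leq_trans n2.
  have eps0 : 0 < eps by apply: lt_le_trans eps_ge; rewrite div1r invr_gt0.
  have e2 : 0 < eps ^+ 2 by rewrite exprn_gt0.
  have L0 : 0 < ln (n%:R : RR) by have := @ln_ge_half RR n n2; lra.
  pose x := 8 * (64 * 64) / eps ^+ 2 * ln (n%:R : RR) ^+ 2.
  have x0 : 0 < x by rewrite mulr_gt0 ?exprn_gt0 // divr_gt0 // !mulr_gt0.
  have rho_ge : x <= rho%:R.
    apply: le_trans (ceil_ge _) _; rewrite -[rho%:R]/(rho%:Z%:~R) ler_int.
    by rewrite /rho /rounds -/x abszE ler_norm.
  have rho0 : (0 < rho)%N by rewrite -(ltr_nat RR); apply: lt_le_trans rho_ge.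
  rewrite powR_inv1 ?(ltW n0) //.
  apply: (prob_cut_approx_ge loopless u_gt0 conn rho0 n2 eps0).
  by rewrite -ler_pdivrMr // mulrAC.
(* With at most one vertex a loopless graph has no edges, so all cuts are empty and the probability
   is 1. *)
have noE (e : E) : False.
  have := max_card (mem [set s e; t e]%SET).
  by rewrite cards2 loopless => /leq_trans/(_ n1).
suff -> : prob_cut_approx s t u rho eps = 1 by rewrite gerBl powR_ge0.
rewrite /prob_cut_approx.
have -> : [set f : outcome u rho | valid s t f && cut_approx s t eps f]
   = [set f : outcome u rho | valid s t f].
  apply/setP => f; rewrite !inE andbC [cut_approx _ _ _ _](_ : _ = true) //.
  apply/forallP => S; rewrite !big1 ?subrr ?normr0 ?mulr0 //.
by rewrite GRing.divff ?gt_eqF ?card_valid_gt0.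
Qed.
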